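(* Let $d>0$ and $0<r\le n$ be integers and let $\mathbf{m}=(m_1,\ldots,m_n)$ be an $r$-semiuniform sequence of integers, not all zero. Put $M_i=m_1+\cdots+m_i$ for $1\le i\le n$, and define integers $u\ge 0$ and $\rho$ by $M_n=ur+\rho$ with $0<\rho\le r$ (so $u=\lceil M_n/r\rceil-1$ and $\rho=M_n-ru$). Let $g=(d-1)(d-2)/2$, and let $s$ be the largest integer such that both $(s+1)(s+2)\le 2\rho$ and $0\le s<d$. (a) If $r\le d^2$, then (i) $\alpha(\mathbf{m})\ge 1+\min\left(\lfloor (M_r+g-1)/d\rfloor,\ s+ud\right)$ whenever $d(d+1)/2\le r$, while (ii) $\tau(\mathbf{m})\le \max\left(\lceil(\rho+g-1)/d\rceil+ud,\ ud+d-2\right)$. (b) If $2r\ge n+d^2$, then (i) $\alpha(\mathbf{m})\ge s+ud+1$, and (ii) $\tau(\mathbf{m})\le \max\left(\lceil (M_r+g-1)/d\rceil,\ ud+d-2\right)$. (c) If for some $m$ we have $m_i=m$ for all $i$, and $rd(d+1)/2\le r^2\le d^2n$, then $\alpha(\mathbf{m})\ge 1+\min\left(\lfloor (mr+g-1)/d\rfloor,\ s+ud\right)$.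
   Context: Work over the complex numbers. Let $R=\mathbf{C}[\mathbf{P}^2]$ be the homogeneous coordinate ring of $\mathbf{P}^2$. For a sequence $\mathbf{m}=(m_1,\ldots,m_n)$ of nonnegative integers and general points $p_1,\ldots,p_n\in\mathbf{P}^2$ (''general'' means in a suitable nonempty Zariski open set of $n$-tuples, which may depend on $\mathbf{m}$), $I(\mathbf{m})\subset R$ is the ideal generated by all forms having multiplicity at least $m_i$ at $p_i$ for every $i$, and $h(\mathbf{m})(t)=\dim_{\mathbf{C}} I(\mathbf{m})_t$ for integers $t\ge0$. $\alpha(\mathbf{m})$ is the least degree $t$ with $h(\mathbf{m})(t)>0$, and $\tau(\mathbf{m})$ is the least degree $t\ge 0$ with $h(\mathbf{m})(t)=\binom{t+2}{2}-\sum_{i=1}^n\binom{m_i+1}{2}$. Given an integer $0<r\le n$, the sequence $(m_1,\ldots,m_n)$ is called $r$-semiuniform if $m_r+1\ge m_1\ge m_2\ge\cdots\ge m_n\ge 0$. *)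

(* Defs.v *)
From HB Require Import structures.
From mathcomp Require Import all_boot all_order all_algebra.
From mathcomp Require Import boolp reals complex mpoly.

Set Implicit Arguments.
Unset Strict Implicit.
Unset Printing Implicit Defensive.

Import Order.TTheory GRing.Theory Num.Theory.
Local Open Scope ring_scope.

(* P^2 as the set of lines through the origin of K^3. *)
Definition P2 (K : fieldType) : Type :=
  {L : {vspace 'rV[K]_3} | \dim L == 1%N}.

(* Homogeneous coordinates; the choice of the nonzero vector on the line does
   not matter below, where only ratios and multihomogeneous polynomials are
   evaluated. *)
Definition hcoord (K : fieldType) (p : P2 K) : 'rV[K]_3 := vpick (val p).

(* Polynomials on (K^3)^n: the variable of index mxvec_index i j is the j-th
   homogeneous coordinate of the i-th point. *)
Definition multihomog (K : fieldType) (n : nat) (f : {mpoly K[n * 3]}) : Prop :=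
  exists e : 'I_n -> nat, forall mon, mon \in msupp f ->
    forall i : 'I_n, (\sum_(j < 3) mon (mxvec_index i j))%N = e i.

Definition eval_points (K : fieldType) (n : nat) (f : {mpoly K[n * 3]})
    (p : n.-tuple (P2 K)) : K :=
  f.@[fun k => mxvec (\matrix_(i < n, j < 3) hcoord (tnth p i) 0 j) 0 k].

Definition zariski_open (K : fieldType) (n : nat)
    (U : n.-tuple (P2 K) -> Prop) : Prop :=
  exists S : {mpoly K[n * 3]} -> Prop,
    (forall f, S f -> multihomog f) /\
    (forall p, U p <-> exists f, S f /\ eval_points f p != 0).

Definition general_points (K : fieldType) (n : nat)
    (Q : n.-tuple (P2 K) -> Prop) : Prop :=
  exists U : n.-tuple (P2 K) -> Prop,
    [/\ zariski_open U, exists p, U p & forall p, U p -> Q p].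

(* Local equation at p of the curve F = 0: dehomogenize in the affine chart
   x_j = 1 and translate p to the origin. Meaningful when the j-th homogeneous
   coordinate of p is nonzero. *)
Definition local_eq (K : fieldType) (F : {mpoly K[3]}) (p : P2 K) (j : 'I_3) :
    {mpoly K[2]} :=
  F \mPo [tuple if unlift j i is Some k
                then (hcoord p 0 i / hcoord p 0 j)%:MP + 'X_k
                else 1 | i < 3].

Definition mult_ge (K : fieldType) (F : {mpoly K[3]}) (p : P2 K) (k : nat) :
    Prop :=
  forall j : 'I_3, hcoord p 0 j != 0 ->
    forall mon : 'X_{1..2}, (mdeg mon < k)%N -> (local_eq F p j)@_mon = 0.

Definition ideal_gen (A : comNzRingType) (S : A -> Prop) (F : A) : Prop :=
  exists s : seq (A * A),
    (forall x, x \in s -> S x.2) /\ F = \sum_(x <- s) x.1 * x.2.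

Definition fat_form (K : fieldType) (n : nat) (m : n.-tuple nat)
    (p : n.-tuple (P2 K)) (F : {mpoly K[3]}) : Prop :=
  (exists t, F \is t.-homog) /\
  forall i : 'I_n, mult_ge F (tnth p i) (tnth m i).

Definition fat_ideal (K : fieldType) (n : nat) (m : n.-tuple nat)
    (p : n.-tuple (P2 K)) : {mpoly K[3]} -> Prop :=
  ideal_gen (fat_form m p).

Lemma ideal_gen_lin (K : fieldType) (S : {mpoly K[3]} -> Prop) (a : K) F G :
  ideal_gen S F -> ideal_gen S G -> ideal_gen S (a *: F + G).
Proof.
case=> s [sS ->]; case=> s' [s'S ->].
exists ([seq (a *: x.1, x.2) | x <- s] ++ s'); split.
  move=> x; rewrite mem_cat => /orP[/mapP[y ys ->]|/s'S//].
  exact: (sS y ys).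
rewrite big_cat big_map /= scaler_sumr; congr (_ + _).
by apply: eq_bigr => x _; rewrite scalerAl.
Qed.

Lemma vspace_of_pred (K : fieldType) (V : vectType K) (A : V -> Prop) :
  A 0 -> (forall a u v, A u -> A v -> A (a *: u + v)) ->
  exists W : {vspace V}, forall v, v \in W <-> A v.
Proof.
move=> A0 AD.
pose P k := `[< exists W : {vspace V}, \dim W = k /\ forall v, v \in W -> A v >].
have exP : exists k, P k.
  exists 0%N; apply/asboolP; exists 0%VS; split; first by rewrite dimv0.
  by move=> v; rewrite memv0 => /eqP ->.
have leP k : P k -> (k <= \dim {:V})%N.
  by move=> /asboolP[W [<- _]]; apply: dimvS (subvf _).
case: (ex_maxnP exP leP) => k /asboolP[W [dimW WA]] kmax.
exists W => v; split=> [/WA//|Av].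
suff /kmax : P (\dim (W + <[v]>)%VS).
  move=> le_dim; have : (W == W + <[v]>)%VS by rewrite eqEdim addvSl dimW.
  move=> /eqP ->; exact: subvP (addvSr W <[v]>) v (memv_line v).
apply/asboolP; exists (W + <[v]>)%VS; split=> // w.
case/memv_addP => x /WA Ax [_ /vlineP[c ->] ->].
by rewrite addrC; apply: AD.
Qed.

Lemma ideal_part_exists (K : fieldType) (S : {mpoly K[3]} -> Prop) (t : nat) :
  exists W : {vspace dhomog 3 K t},
    forall F, F \in W <-> ideal_gen S (F : {mpoly K[3]}).
Proof.
apply: (@vspace_of_pred K _ (fun F : dhomog 3 K t =>
  ideal_gen S (F : {mpoly K[3]}))) => [|a F G SF SG].
  by exists [::]; rewrite big_nil raddf0.
by rewrite linearP /=; apply: ideal_gen_lin.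
Qed.

(* I(m)_t, as a subspace of the space of forms of degree t. *)
Definition fat_part (K : fieldType) (n : nat) (m : n.-tuple nat)
    (p : n.-tuple (P2 K)) (t : nat) : {vspace dhomog 3 K t} :=
  sval (cid (ideal_part_exists (fat_form m p) t)).

Lemma mem_fat_part (K : fieldType) (n : nat) (m : n.-tuple nat)
    (p : n.-tuple (P2 K)) (t : nat) (F : dhomog 3 K t) :
  F \in fat_part m p t <-> fat_ideal m p (F : {mpoly K[3]}).
Proof. exact: (svalP (cid (ideal_part_exists _ t))). Qed.

Definition hilb (K : fieldType) (n : nat) (m : n.-tuple nat)
    (p : n.-tuple (P2 K)) (t : nat) : nat := \dim (fat_part m p t).

Definition is_least (A : nat -> Prop) (a : nat) : Prop :=
  A a /\ forall t, A t -> (a <= t)%N.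

Definition is_greatest (A : nat -> Prop) (a : nat) : Prop :=
  A a /\ forall t, A t -> (t <= a)%N.

Definition is_alpha (K : fieldType) (n : nat) (m : n.-tuple nat)
    (p : n.-tuple (P2 K)) : nat -> Prop :=
  is_least (fun t => (0 < hilb m p t)%N).

(* The equality is in int: the right-hand side may be negative. *)
Definition is_tau (K : fieldType) (n : nat) (m : n.-tuple nat)
    (p : n.-tuple (P2 K)) : nat -> Prop :=
  is_least (fun t => (hilb m p t)%:Z =
    'C(t.+2, 2)%:Z - \sum_(i < n) 'C((tnth m i).+1, 2)%:Z).

(* The entries m_1, ..., m_n are indexed from 0. *)
Definition semiuniform (n r : nat) (m : n.-tuple nat) : Prop :=
  (nth 0 m 0 <= (nth 0 m r.-1).+1)%N /\ sorted geq m.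

(* M_k = m_1 + ... + m_k *)
Definition psum (n : nat) (m : n.-tuple nat) (k : nat) : nat :=
  (\sum_(i < k) nth 0 m i)%N.

(* Main.v *)
Require Import Defs.
From HB Require Import structures.
From mathcomp Require Import all_boot all_order all_algebra.
From mathcomp Require Import perm boolp reals complex mpoly ssrcomplements.
From mathcomp Require Import zify ring.

Set Implicit Arguments.
Unset Strict Implicit.
Unset Printing Implicit Defensive.

Import Order.TTheory GRing.Theory Num.Theory.

(** Let C be the curve y = x^d and Gamma the arc y = x^d + (x - 1)^r, which
    meets C at (1, 1) to order exactly r. Put the n points on Gamma and let them
    all tend to (1, 1). In coordinates (x, y) in which Gamma is y = 0, the ideal
    of the fat points degenerates to the monomial ideal I_c generated by the
    y^j (x - 1)^(c_j), where c_j = sum_i max(m_i - j, 0), so the generic Hilbert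
    function is bounded above by that of I_c.

    An element of I_c of degree t restricts to C with a zero of order at least
    M_r = m_1 + ... + m_r at (1, 1). The restriction is a polynomial in x with
    at most N monomials, N being the dimension of the forms of degree t modulo
    the equation of C; in characteristic 0, vanishing at 1 to order M_r imposes
    min(M_r, N) independent conditions on such polynomials. The residual curve
    lies in I_(c - r): semiuniformity says exactly that
    c_(j+1) <= max(c_j - r, 0), which makes the residuation work and is
    preserved by it. After u + 1 residuations nothing is left, and both bounds
    come down to comparing N with M_r at each step. *)

(** * Arithmetic of the residuation *)

Definition drops (r : nat) (c : nat -> nat) : Prop :=
  forall j, (c j.+1 <= c j - r)%N.

(* For c = col_sum m below, with m r-semiuniform and c_J = 0, this is
   M_r = m_1 + ... + m_r. *)
Definition mu (r J : nat) (c : nat -> nat) : nat :=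
  (\sum_(j < J) minn r (c j))%N.

(* The dimension of the forms of degree T - 1 modulo the equation of a plane
   curve of degree d. *)
Definition curve_dim (d T : nat) : nat := (\sum_(i < d) (T - i))%N.

(* Bounds the dimension of the space of polynomials of degree < T in I_c by
   restricting to C and residuating k times. *)
Fixpoint hbound (d r J k T : nat) (c : nat -> nat) : nat :=
  if k is k'.+1 then
    (curve_dim d T - mu r J c + hbound d r J k' (T - d) (fun j => c j - r))%N
  else 'C(T.+1, 2).

Lemma drops_shift r c : drops r c -> drops r (fun j => c j.+1).
Proof. by move=> H j; apply: H. Qed.

Lemma drops_sub r c k : drops r c -> drops r (fun j => c j - k)%N.
Proof. by move=> H j; move: (H j); lia. Qed.

Lemma drops_le r c j : drops r c -> (c j <= c 0)%N.
Proof. by move=> H; elim: j => // j IH; move: (H j); lia. Qed.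

Lemma muS r J c : mu r J.+1 c = (minn r (c 0) + mu r J (fun j => c j.+1))%N.
Proof. by rewrite /mu big_ord_recl. Qed.

(** Under [drops r c] each summand min(r, c_j) is at most c_j - c_(j+1), so the sum telescopes. *)
Lemma mu_le0 r J c : drops r c -> (mu r J c <= c 0)%N.
Proof.
elim: J c => [|J IH] c H; first by rewrite /mu big_ord0.
by rewrite muS; move: (IH _ (drops_shift H)) (H 0%N); lia.
Qed.

(** The number c_j + j r is the order along C at (1, 1) of the generator y^j (x - 1)^(c_j), so this
    makes every element of I_c vanish there to order [mu r J c]. The first j summands are at most r
    each and the others telescope to at most c_j. *)
Lemma mu_le r J c j : drops r c -> (mu r J c <= c j + j * r)%N.
Proof.
elim: j J c => [|j IH] J c H; first by rewrite addn0; apply: mu_le0.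
case: J => [|J]; first by rewrite /mu big_ord0.
by rewrite muS; move: (IH J _ (drops_shift H)); lia.
Qed.

Lemma mu_ge0 r J c : c J = 0%N -> (minn r (c 0) <= mu r J c)%N.
Proof. by case: J => [->|J _]; [lia|rewrite muS leq_addr]. Qed.

(** [drops] puts c - r above c shifted by one index, so only the first summand, at most r, can be
    lost. *)
Lemma mu_sub_ge r J c : drops r c ->
  (mu r J c <= mu r J (fun j => c j - r) + r)%N.
Proof.
case: J => [|J] H; first by rewrite /mu big_ord0.
rewrite muS addnC leq_add ?geq_minl //.
rewrite [leqRHS]/mu big_ord_recr /= (leq_trans _ (leq_addr _ _)) //.
by apply: leq_sum => j _; move: (H j); lia.
Qed.

(** While c_1 >= r, the first summands on both sides equal r and cancel. At the last column with c_0
    >= r the residual sum is at most c_0 - r, while [mu r J c] is at least r + c_1, hence at least r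
    + c_0 - n. *)
Lemma mu_sub_le r n J c : drops r c -> (forall j, c j <= c j.+1 + n)%N ->
  c J = 0%N -> (r <= c 0)%N ->
  (mu r J (fun j => c j - r) + 2 * r <= mu r J c + n)%N.
Proof.
elim: J c => [|J IH] c H Hn cJ rc0; first by rewrite /mu !big_ord0; lia.
rewrite !muS.
have [rc1|c1r] := leqP r (c 1%N).
  by move: (IH _ (drops_shift H) (fun j => Hn j.+1) cJ rc1) (H 0%N); lia.
have -> : mu r J (fun j => c j.+1 - r)%N = 0%N.
  rewrite /mu big1 // => j _.
  by move: (drops_le j (drops_shift H)) => /=; lia.
by move: (mu_ge0 (c := fun j => c j.+1) r cJ) (Hn 0%N) (H 0%N) => /=; lia.
Qed.

(** Termwise r (c_j - c_(j+1)) <= n min(r, c_j): if c_j >= r because the step is at most n,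
    otherwise because c_(j+1) = 0 and r <= n. The left-hand sides telescope. *)
Lemma mu_avg r n J c : drops r c -> (forall j, c j <= c j.+1 + n)%N ->
  c J = 0%N -> (r <= n)%N -> (r * c 0 <= n * mu r J c)%N.
Proof.
elim: J c => [|J IH] c H Hn cJ rn; first by rewrite cJ muln0.
rewrite muS; move: (IH _ (drops_shift H) (fun j => Hn j.+1) cJ rn).
by move: (Hn 0%N) (H 0%N) => /=; case: (leqP r (c 0%N)); nia.
Qed.

Lemma binS2 T : 'C(T.+1, 2) = ('C(T, 2) + T)%N.
Proof. by rewrite binS bin1 addnC. Qed.

Lemma bin2_mul T : ('C(T.+1, 2) * 2 = T.+1 * T)%N.
Proof. by elim: T => // T IH; rewrite binS2; lia. Qed.

(** The dimension count for multiplication by the equation of C: it embeds the polynomials of degree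
    < T - d into those of degree < T. *)
Lemma curve_dim_bin d T : (curve_dim d T + 'C((T - d).+1, 2) = 'C(T.+1, 2))%N.
Proof.
elim: d => [|d IH]; first by rewrite /curve_dim big_ord0 subn0.
rewrite /curve_dim big_ord_recr /= -/(curve_dim d T) -IH.
have -> : (T - d = T - d.+1 + (d < T))%N by lia.
case: ltnP => [dT|Td]; first by rewrite addn1 [in RHS]binS2; lia.
by rewrite !addn0 (_ : T - d.+1 = 0)%N ?addn0 //; lia.
Qed.

(** With T = t + 1 and g the arithmetic genus of C this is the Riemann-Roch value d t + 1 - g. The
    condition d <= T + 1 says that no difference T - i is truncated. *)
Lemma curve_dim_large d T : (d <= T.+1)%N ->
  (curve_dim d T + 'C(d, 2) = d * T)%N.
Proof.
elim: d => [|d IH] dT; first by rewrite /curve_dim big_ord0.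
rewrite /curve_dim big_ord_recr /= -/(curve_dim d T) binS2.
by move: (IH (ltnW dT)); lia.
Qed.

Lemma curve_dim_ge d T : (d * T <= curve_dim d T + 'C(d, 2))%N.
Proof.
elim: d => [|d IH]; first by rewrite /curve_dim big_ord0.
by rewrite /curve_dim big_ord_recr /= -/(curve_dim d T) binS2; lia.
Qed.

Lemma curve_dim_mono d T T' : (T <= T')%N ->
  (curve_dim d T <= curve_dim d T')%N.
Proof. by move=> TT'; apply: leq_sum => i _; apply: leq_sub2r. Qed.

(** Every truncated difference in [hbound] is zero, and after k residuations no degree is left. *)
Lemma hbound_eq0 d r J k T c :
  (forall i, (i < k)%N ->
     curve_dim d (T - i * d) <= mu r J (fun j => c j - i * r))%N ->
  (T <= k * d)%N -> hbound d r J k T c = 0%N.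
Proof.
elim: k T c => [|k IH] T c H Tk /=; first by rewrite (_ : T = 0)%N //; lia.
have := H 0%N isT; rewrite mul0n subn0.
have -> : mu r J (fun j => c j - 0 * r)%N = mu r J c.
  by apply: eq_bigr => j _; rewrite mul0n subn0.
move=> H0; rewrite IH ?addn0; [by apply/eqP; rewrite subn_eq0| |lia].
move=> i ik; have := H i.+1 ik.
rewrite [(i.+1 * d)%N]mulSn subnDA => /leq_trans; apply.
by apply: leq_sum => j _; rewrite mulSn subnDA.
Qed.

(** The opposite regime: no difference is truncated, so the recursion telescopes through
    [curve_dim_bin]. *)
Lemma hbound_exact d r J k T c :
  (forall i, (i < k)%N ->
     mu r J (fun j => c j - i * r) <= curve_dim d (T - i * d))%N ->
  (hbound d r J k T c + \sum_(i < k) mu r J (fun j => c j - i * r) =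
    'C(T.+1, 2))%N.
Proof.
elim: k T c => [|k IH] T c H /=; first by rewrite big_ord0 addn0.
have := H 0%N isT; rewrite mul0n subn0.
have E0 : mu r J (fun j => c j - 0 * r)%N = mu r J c.
  by apply: eq_bigr => j _; rewrite mul0n subn0.
rewrite E0 => H0; rewrite big_ord_recl /= E0 -(curve_dim_bin d T).
rewrite -(IH (T - d)%N (fun j => c j - r)%N).
  set S1 := (\sum_(i < k) _)%N; set S2 := (\sum_(i < k) _)%N.
  suff -> : S1 = S2 by lia.
  apply: eq_bigr => i _; apply: eq_bigr => j _.
  by rewrite /bump /= add1n mulSn subnDA.
move=> i ik; have := H i.+1 ik.
rewrite [(i.+1 * d)%N]mulSn subnDA => /(leq_trans _); apply.
by apply: leq_sum => j _; rewrite mulSn subnDA.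
Qed.

(** Column by column, the k residuations remove c_j in portions of size at most r. *)
Lemma sum_mu r J k c : (forall j, c j <= k * r)%N ->
  (\sum_(i < k) mu r J (fun j => c j - i * r) = \sum_(j < J) c j)%N.
Proof.
move=> H; rewrite /mu exchange_big /=; apply: eq_bigr => j _.
suff -> : forall l, (\sum_(i < l) minn r (c j - i * r) = minn (c j) (l * r))%N.
  by move: (H j); lia.
elim=> [|l IH]; first by rewrite big_ord0; lia.
by rewrite big_ord_recr /= IH; lia.
Qed.

Lemma mu0E r J c : mu r J (fun j => c j - 0 * r)%N = mu r J c.
Proof. by apply: eq_bigr => j _; rewrite mul0n subn0. Qed.

Lemma muSE r J c i : mu r J (fun j => c j - i.+1 * r)%N =
  mu r J (fun j => c j - i * r - r)%N.
Proof. by apply: eq_bigr => j _; rewrite mulSn addnC subnDA. Qed.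

Lemma mu_step_ge r J c i : drops r c ->
  (mu r J c <= mu r J (fun j => c j - i * r) + i * r)%N.
Proof.
move=> dc; elim: i => [|i IH]; first by rewrite mu0E addn0.
by have := mu_sub_ge J (drops_sub (i * r) dc); rewrite -muSE; lia.
Qed.

(** * Numerical estimates behind the three cases *)

Section Steps.
Variables (d r J u rho n : nat) (c : nat -> nat).
Hypotheses (d_gt0 : (0 < d)%N) (dc : drops r c) (cJ : c J = 0%N).
Hypotheses (c0 : c 0 = (u * r + rho)%N) (rho_gt0 : (0 < rho)%N)
  (rho_le : (rho <= r)%N).

Local Notation mui i := (mu r J (fun j => c j - i * r)%N).
Local Notation g := 'C(d.-1, 2).

Lemma genus_step : ('C(d, 2) = g + d.-1)%N.
Proof. by rewrite -{1}(prednK d_gt0) binS2. Qed.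

Lemma mu_last : (rho <= mui u)%N.
Proof.
apply: leq_trans (mu_ge0 _ _); last by rewrite cJ.
by rewrite c0 addKn leq_min rho_le leqnn.
Qed.

Lemma mu_mid i : (i < u)%N -> (r <= mui i)%N.
Proof.
move=> iu; apply: leq_trans (mu_ge0 _ _); last by rewrite cJ.
by rewrite c0 leq_min leqnn leq_subRL; nia.
Qed.

Lemma mu_total : (\sum_(i < u.+1) mui i = \sum_(j < J) c j)%N.
Proof. by apply: sum_mu => j; have := drops_le j dc; rewrite c0; lia. Qed.

(** The choice of s settles the last residuation: the remaining degree is at most s < d, and there
    are only (s + 1)(s + 2) / 2 <= rho monomials of degree at most s. *)
Lemma alpha_core s t : (s.+1 * s.+2 <= 2 * rho)%N -> (s < d)%N ->
  (t <= s + u * d)%N ->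
  (forall i, (i < u)%N -> curve_dim d (t.+1 - i * d) <= mui i)%N ->
  hbound d r J u.+1 t.+1 c = 0%N.
Proof.
move=> srho sd tsu H; apply: hbound_eq0; last by lia.
move=> i; rewrite ltnS leq_eqVlt => /predU1P[->|]; last exact: H.
apply: leq_trans mu_last; apply: (@leq_trans (curve_dim d s.+1)).
  by apply: curve_dim_mono; lia.
have := curve_dim_bin d s.+1; rewrite (_ : s.+1 - d = 0)%N; last by lia.
by rewrite addn0; have := bin2_mul s.+1; lia.
Qed.

(** For large degrees [curve_dim] falls by exactly d^2 per residuation, while the hypothesis lets
    the orders fall below A by at most d^2 per step; so the comparison at the start persists. A is
    M_r in case (a) and m r in case (c). *)
Lemma alpha_drop A s t : (s.+1 * s.+2 <= 2 * rho)%N -> (s < d)%N ->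
  (t <= s + u * d)%N -> ('C(d.+1, 2) <= r)%N -> (t * d < A + g)%N ->
  (forall i, (i < u)%N -> A <= mui i + i * d ^ 2)%N ->
  hbound d r J u.+1 t.+1 c = 0%N.
Proof.
move=> srho sd tsu dr tA HA; apply: (alpha_core srho sd tsu) => i iu.
(* In degrees too small for the linear formula, C(d + 1, 2) bounds [curve_dim], and r bounds the
   order from below before the last step. *)
have [Td|dT] := leqP (t.+1 - i * d) d.
  apply: leq_trans (mu_mid iu); apply: leq_trans dr.
  apply: leq_trans (curve_dim_mono d Td) _.
  by have := curve_dim_bin d d; lia.
have := @curve_dim_large d (t.+1 - i * d) ltac:(lia).
have := HA i iu; have := genus_step.
by move: (curve_dim _ _) (mui i) => X Y; nia.
Qed.

(** Here the orders fall by at least d^2 per step, so the comparison is made at the last step and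
    carried backwards: going back, the orders gain at least what [curve_dim] gains. *)
Lemma alpha_steep s t : (s.+1 * s.+2 <= 2 * rho)%N -> (s < d)%N ->
  (t <= s + u * d)%N ->
  (forall i, (i < u)%N -> mui i.+1 + d ^ 2 <= mui i)%N ->
  hbound d r J u.+1 t.+1 c = 0%N.
Proof.
move=> srho sd tsu Hs; apply: (alpha_core srho sd tsu) => i iu.
have chain k : (k <= u)%N -> (rho + k * d ^ 2 <= mui (u - k))%N.
  elim: k => [|k IH] ku; first by rewrite subn0 addn0 mu_last.
  have := Hs (u - k.+1)%N ltac:(lia); rewrite (_ : (u - k.+1).+1 = u - k)%N.
    by have := IH ltac:(lia); lia.
  by lia.
have := chain (u - i)%N ltac:(lia); rewrite subKn; last by lia.
apply: leq_trans.
apply: (@leq_trans (curve_dim d (s.+1 + (u - i) * d))).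
  by apply: curve_dim_mono; nia.
have := @curve_dim_large d (s.+1 + (u - i) * d) ltac:(nia).
have := curve_dim_ge d s.+1.
have := curve_dim_bin d s.+1; rewrite (_ : s.+1 - d = 0)%N; last by lia.
rewrite addn0; have := bin2_mul s.+1.
by move: (curve_dim _ _) (curve_dim _ _) => X Y; nia.
Qed.

(** The condition t >= u d + d - 2 keeps each of the u + 1 residual degrees in the range where
    [curve_dim_large] applies. *)
Lemma tau_core A t : (A + g <= (t * d).+1)%N -> (u * d + d <= t.+2)%N ->
  (forall i, (i <= u)%N -> mui i + i * d ^ 2 <= A)%N ->
  (hbound d r J u.+1 t.+1 c + \sum_(j < J) c j = 'C(t.+2, 2))%N.
Proof.
move=> tA tu HA; rewrite -mu_total; apply: hbound_exact => i.
rewrite ltnS => iu.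
have := @curve_dim_large d (t.+1 - i * d) ltac:(nia).
have := HA i iu; have := genus_step.
by move: (curve_dim _ _) (mui i) => X Y; nia.
Qed.

(** The order is at most c_0 - i r = rho + (u - i) r, and r <= d^2. *)
Lemma mu_flat i : (i <= u)%N -> (r <= d ^ 2)%N ->
  (mui i + i * d ^ 2 <= rho + u * d ^ 2)%N.
Proof.
move=> iu rd; have := mu_le0 J (drops_sub (i * r) dc); rewrite c0 => h.
apply: leq_trans (leq_add h (leqnn _)) _.
by nia.
Qed.

Hypothesis cn : forall j, (c j <= c j.+1 + n)%N.

Lemma mu_steep i : (n + d ^ 2 <= 2 * r)%N -> (i < u)%N ->
  (mui i.+1 + d ^ 2 <= mui i)%N.
Proof.
move=> nd iu; have := @mu_sub_le r n J (fun j => c j - i * r)%N.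
rewrite -muSE => /(_ (drops_sub _ dc)) h.
have := h (fun j => ltac:(have := cn j; lia)) ltac:(rewrite cJ; lia).
by rewrite c0 => /(_ ltac:(nia)); lia.
Qed.

Lemma mu_steep_chain i : (n + d ^ 2 <= 2 * r)%N -> (i <= u)%N ->
  (mui i + i * d ^ 2 <= mu r J c)%N.
Proof.
move=> nd; elim: i => [|i IH] iu; first by rewrite mu0E addn0.
by have := mu_steep nd iu; have := IH (ltnW iu); lia.
Qed.

(** Averaging gives an order of at least r (b n - i r) / n = b r - i r^2 / n, and r^2 <= d^2 n. *)
Lemma mu_uniform i b : (r <= n)%N -> (c 0 = b * n)%N ->
  (r ^ 2 <= d ^ 2 * n)%N ->
  (i <= u)%N -> (b * r <= mui i + i * d ^ 2)%N.
Proof.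
move=> rn cb rd iu; have := @mu_avg r n J (fun j => c j - i * r)%N.
move=> /(_ (drops_sub _ dc) (fun j => ltac:(have := cn j; lia))).
move=> /(_ ltac:(rewrite cJ; lia) rn).
have n0 : (0 < n)%N by lia.
rewrite cb mulnBr leq_subLR => h1.
have h2 : (i * r ^ 2 <= i * (d ^ 2 * n))%N by rewrite leq_mul2l rd orbT.
rewrite -(leq_pmul2l n0); move: h1 h2; move: (mui i) (d ^ 2)%N => X D.
rewrite -mulnn.
have -> : (r * (b * n) = n * (b * r))%N by lia.
have -> : (r * (i * r) = i * (r * r))%N by lia.
have -> : (n * (X + i * D) = n * X + i * (D * n))%N by lia.
by lia.
Qed.
End Steps.

Local Open Scope ring_scope.

(** * Plane curves restricted to y = x^d *)

Lemma dvdp_deriv_exp (K : fieldType) (d p : {poly K}) k :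
  d ^+ k.+1 %| p -> d ^+ k %| p^`().
Proof.
case/dvdpP => w ->; rewrite derivM deriv_exp /= -mulrnAl exprS.
apply: dvdp_add; first by rewrite mulrA dvdp_mulIr.
by apply: dvdp_mull; rewrite dvdp_mulIr.
Qed.

(* The operator p |-> X p' - e p removes the exponent e from the support and
   lowers the order of vanishing at 1 by at most one. *)
Lemma fewnomial_eq0 (K : numFieldType) (s : seq nat) (p : {poly K}) :
  (forall i, p`_i != 0 -> i \in s) -> ('X - 1%:P) ^+ size s %| p -> p = 0.
Proof.
elim: s p => [|e s IH] p ps dp.
  by apply/polyP => i; rewrite coef0; apply/eqP/negPn/negP => /ps.
pose q := 'X * p^`() - e%:R *: p.
have qE i : q`_i = (i%:R - e%:R) * p`_i.
  rewrite /q coefB coefZ mulrBl; congr (_ - _).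
  by rewrite coefXM; case: i => [|i]; rewrite ?mul0r //= coef_deriv mulr_natl.
have q0 : q = 0.
  apply: IH => [i|].
    rewrite qE mulf_eq0 negb_or subr_eq0 => /andP[ie /ps].
    by rewrite inE => /predU1P[iE|//]; rewrite iE eqxx in ie.
  apply: dvdp_sub; first by apply: dvdp_mull; apply: dvdp_deriv_exp.
  rewrite -mul_polyC; apply: dvdp_mull; apply: dvdp_trans dp.
  exact: dvdp_exp2l.
have pE : p = p`_e *: 'X^e.
  apply/polyP => i; rewrite coefZ coefXn.
  have [->|ie] := eqVneq i e; first by rewrite mulr1.
  rewrite mulr0; have /eqP := qE i; rewrite q0 coef0 eq_sym mulf_eq0.
  by rewrite subr_eq0 eqr_nat (negbTE ie) => /eqP.
have : root p 1.
  by rewrite -dvdp_XsubCl; apply: dvdp_trans dp; rewrite /= exprS dvdp_mulr.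
rewrite pE rootE hornerZ hornerXn expr1n mulr1 => /eqP ->.
by rewrite scale0r.
Qed.

Section Bivariate.
Variable K : numFieldType.
Implicit Types (f g q : {poly {poly K}}) (c : nat -> nat).

(* The outer variable of {poly {poly K}} is y, the inner one is x. *)

Definition deg_lt (T : nat) f : Prop :=
  forall i j, (T <= i + j)%N -> f`_j`_i = 0.

(** For nonincreasing c this is membership in the monomial ideal I_c. *)
Definition vanishing c g : Prop :=
  forall j, ('X - 1%:P) ^+ c j %| g`_j.

Definition curve_eq (d : nat) : {poly {poly K}} := 'X - ('X^d)%:P.

Definition arc_poly (d r : nat) : {poly K} := 'X^d + ('X - 1%:P) ^+ r.

(** In the new coordinates the arc is y = 0 and C is y = - (x - 1)^r. *)
Definition straighten (d r : nat) f : {poly {poly K}} :=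
  f \Po ('X + (arc_poly d r)%:P).

Lemma vanishing_restrict c r m g : (forall j, (m <= c j + j * r)%N) ->
  vanishing c g -> ('X - 1%:P) ^+ m %| g.[- ('X - 1%:P) ^+ r].
Proof.
move=> mc vg; rewrite horner_coef; apply: (big_ind (fun p => _ %| p)).
- exact: dvdp0.
- by move=> p q; apply: dvdp_add.
move=> j _; apply: (dvdp_trans (dvdp_exp2l _ (mc j))).
rewrite exprD; apply: dvdp_mul; first exact: vg.
by rewrite exprNn mulnC exprM dvdp_mull.
Qed.

Lemma straighten_horner d r f :
  (straighten d r f).[- ('X - 1%:P) ^+ r] = f.['X^d].
Proof.
rewrite /straighten horner_comp hornerD hornerX hornerC /arc_poly.
by congr (_.[_]); ring.
Qed.

(** In straightened coordinates the factor is y + (x - 1)^r, so the product has the coefficients q_j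
    + (x - 1)^r q_(j+1). Going up in j, the order c_j - r already known for q_j is at least c_(j+1),
    so q_j can be subtracted. *)
Lemma vanishing_residual d r c q : drops r c ->
  vanishing c (straighten d r (q * curve_eq d)) ->
  vanishing (fun j => c j - r)%N (straighten d r q).
Proof.
move=> dc; rewrite /straighten comp_polyM.
have -> : curve_eq d \Po ('X + (arc_poly d r)%:P) = 'X + (('X - 1%:P) ^+ r)%:P.
  rewrite /curve_eq comp_polyB comp_polyX comp_polyC /arc_poly polyCD.
  by ring.
set g := q \Po _ => vg.
have X0 : 'X - 1%:P != 0 :> {poly K} by rewrite polyXsubC_eq0.
suff H j : ('X - 1%:P) ^+ c j %| g`_j * ('X - 1%:P) ^+ r.
  by move=> j; rewrite -(dvdp_exp_sub _ _ _ X0).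
elim: j => [|j IH].
  by have := vg 0%N; rewrite mulrDr coefD coefMX coefMC add0r.
have := vg j.+1; rewrite mulrDr coefD coefMX coefMC /= dvdp_addr //.
rewrite dvdp_exp_sub // in IH.
exact: dvdp_trans (dvdp_exp2l _ (dc j)) IH.
Qed.

Lemma deg_lt_residual d T q : (0 < d)%N ->
  deg_lt T (q * curve_eq d) -> deg_lt (T - d) q.
Proof.
move=> d0 Tf i j; elim: j i => [|j IH] i Tij.
  have := Tf (i + d)%N 0%N; rewrite mulrBr coefB coefMX coefMC /= coefB coef0.
  rewrite coefMXn ltnNge leq_addl addnK /= add0r => /(_ _) /eqP.
  by rewrite oppr_eq0 => H; apply/eqP/H; lia.
have := Tf (i + d)%N j.+1; rewrite mulrBr coefB coefMX coefMC /= coefB.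
rewrite coefMXn ltnNge leq_addl addnK /= IH; last by lia.
rewrite add0r => /(_ _) /eqP.
by rewrite oppr_eq0 => H; apply/eqP/H; lia.
Qed.

(** The monomials x^i y^j with i < d and i + j < T represent the polynomials of degree < T on C,
    where they become x^(i + d j). *)
Definition curve_exps (d T : nat) : seq nat :=
  flatten [seq [seq (i + d * j)%N | j <- iota 0 (T - i)] | i <- iota 0 d].

Lemma size_curve_exps d T : size (curve_exps d T) = curve_dim d T.
Proof.
rewrite size_flatten /shape -map_comp sumnE big_map -{1}[d]subn0.
rewrite -/(index_iota 0 d) big_mkord /curve_dim.
by apply: eq_bigr => i _ /=; rewrite size_map size_iota.
Qed.

(** A monomial x^i y^j with i >= d has the same restriction as x^(i mod d) y^(j + i div d), whose
    degree is no larger because d >= 1. *)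
Lemma restrict_support d T f e : (0 < d)%N -> deg_lt T f ->
  (f.['X^d])`_e != 0 -> e \in curve_exps d T.
Proof.
move=> d0 Tf; apply: contraNT => eS; apply/eqP.
rewrite horner_coef coef_sum big1 // => j _.
rewrite -exprM coefMXn; case: ltnP => // dje; apply: Tf.
rewrite leqNgt; apply: contra eS => lt_T.
set i := (e - d * j)%N in lt_T.
have iE := divn_eq i d.
apply/flattenP.
exists [seq (i %% d + d * l)%N | l <- iota 0 (T - i %% d)].
  apply/mapP; exists (i %% d)%N => //.
  by rewrite mem_iota leq0n add0n ltn_pmod.
apply/mapP; exists (j + i %/ d)%N.
  rewrite mem_iota leq0n /= add0n.
  move: lt_T iE (leq_pmulr (i %/ d) d0).
  move: (i %/ d)%N (i %% d)%N => a b iT iE' ad.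
  rewrite ltn_subRL; apply: leq_ltn_trans iT; rewrite iE'.
  by rewrite addnCA [leqRHS]addnC leq_add2l addnC leq_add2r.
rewrite mulnDr addnCA [(d * (i %/ d))%N]mulnC [(_ %% _ + _)%N]addnC -iE.
by rewrite /i subnKC.
Qed.

Lemma curve_eq_monic d : curve_eq d \is monic.
Proof. exact: monicXsubC. Qed.

Lemma rdivp_linear (D : {poly {poly K}}) (a : {poly K}) f g : D \is monic ->
  Pdiv.CommonRing.rdivp (a *: f + g) D =
  a *: Pdiv.CommonRing.rdivp f D + Pdiv.CommonRing.rdivp g D.
Proof.
move=> mD.
rewrite {1}(Pdiv.RingMonic.rdivp_eq mD f) {1}(Pdiv.RingMonic.rdivp_eq mD g).
rewrite scalerDr addrACA scalerAl -mulrDl.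
rewrite Pdiv.RingMonic.rdivp_addl_mul_small //.
have D0 : D != 0 by apply: monic_neq0.
have sz h : (size (Pdiv.CommonRing.rmodp h D) < size D)%N.
  by rewrite Pdiv.CommonRing.ltn_rmodp.
apply: leq_ltn_trans (size_polyD _ _) _; rewrite gtn_max sz andbT.
exact: leq_ltn_trans (size_scale_leq _ _) (sz f).
Qed.

(** Scalars pass through constants of [{poly K}], since [{poly {poly K}}] carries its module
    structure over [{poly K}]. *)
Definition Klinear h (L : {poly {poly K}} -> 'rV[K]_h) : Prop :=
  forall (a : K) f g, L (a%:P *: f + g) = a *: L f + L g.

Lemma coef_functionals (I : eqType) (s : seq I)
    (phi : I -> {poly {poly K}} -> K) :
  (forall i a f g, phi i (a%:P *: f + g) = a * phi i f + phi i g) ->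
  exists2 L : {poly {poly K}} -> 'rV[K]_(size s), Klinear L &
    forall f, L f = 0 -> {in s, forall i, phi i f = 0}.
Proof.
move=> philin; elim: s => [|x s [L Llin Lf]].
  by exists (fun=> 0) => // a f g; rewrite scaler0 addr0.
pose L' f : 'rV[K]_(1 + size s) := row_mx (phi x f)%:M (L f).
have L'lin : Klinear L'.
  move=> a f g; rewrite /L' philin Llin scale_row_mx add_row_mx.
  by rewrite scale_scalar_mx raddfD.
exists L' => // f L'f.
have /eq_row_mx[/matrixP/(_ 0 0)] : L' f = row_mx 0 0 by rewrite row_mx0.
rewrite !mxE mulr1n => px /Lf {}Lf i.
by rewrite inE => /predU1P[->|/Lf].
Qed.

Lemma limit_functionals d r J c : (0 < d)%N -> drops r c -> forall k T,
  exists2 L : {poly {poly K}} -> 'rV[K]_(hbound d r J k T c), Klinear L &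
    forall f, deg_lt T f -> vanishing c (straighten d r f) -> L f = 0 -> f = 0.
Proof.
move=> d0 + k; elim: k c => [|k IH] c dc T /=.
  pose s := [seq (i, j) | j <- iota 0 T, i <- iota 0 (T - j)].
  have szs : size s = 'C(T.+1, 2).
    rewrite -(curve_dim_bin T T) subnn addn0 size_flatten /shape -map_comp.
    rewrite sumnE big_map -{1}[T]subn0 -/(index_iota 0 T) big_mkord.
    by apply: eq_bigr => i _ /=; rewrite size_map size_iota.
  have [|L Llin Lf] := @coef_functionals _ s (fun ij f => f`_ij.2`_ij.1).
    by move=> ij a f g; rewrite coefD coefZ coefD coefCM.
  rewrite -szs; exists L => // f fT _ /Lf f0.
  apply/polyP => j; apply/polyP => i; rewrite !coef0.
  have [/fT//|ijT] := leqP T (i + j).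
  apply: (f0 (i, j)); apply/allpairsPdep; exists j, i.
  by rewrite !mem_iota /= !add0n; split=> //; lia.
have [L1 L1lin L1f] := IH _ (drops_sub r dc) (T - d)%N.
pose s := curve_exps d T; set m := mu r J c.
(* Only the coefficients beyond the first m exponents are recorded. Once they vanish, the
   restriction has at most m exponents and a zero of order m at 1, so [fewnomial_eq0] applies. *)
have [|L2 L2lin L2f] :=
  @coef_functionals _ (drop m s) (fun e f => (f.['X^d])`_e).
  by move=> e a f g; rewrite hornerD hornerZ coefD coefCM.
have sz2 : size (drop m s) = (curve_dim d T - m)%N.
  by rewrite size_drop size_curve_exps.
rewrite -sz2.
(* Euclidean quotient by the monic y - x^d: it is linear on all f, and exact on those that vanish on
   C. *)
pose quo f := Pdiv.CommonRing.rdivp f (curve_eq d).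
exists (fun f => row_mx (L2 f) (L1 (quo f))) => [a f g|f fT fv].
  by rewrite /= /quo rdivp_linear ?curve_eq_monic // L1lin L2lin
    scale_row_mx add_row_mx.
rewrite -[0]row_mx0 => /eq_row_mx[/L2f f2 f1].
have fX : f.['X^d] = 0.
  have dX : ('X - 1%:P) ^+ m %| f.['X^d].
    rewrite -(straighten_horner d r); apply: vanishing_restrict fv.
    by move=> j; apply: mu_le.
  apply: (@fewnomial_eq0 _ (take m s)) => [e ne0|].
    have := restrict_support d0 fT ne0; rewrite -/s -{1}(cat_take_drop m s).
    by rewrite mem_cat => /orP[//|/f2 e0]; rewrite e0 eqxx in ne0.
  by apply: dvdp_trans dX; apply: dvdp_exp2l; rewrite size_take_min geq_minl.
have fE : f = quo f * curve_eq d.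
  rewrite /quo Pdiv.RingMonic.rdivpK ?curve_eq_monic //.
  by rewrite Pdiv.Ring.rdvdp_XsubCl; apply/rootP.
rewrite fE in fT fv.
suff q0 : quo f = 0 by rewrite fE q0 mul0r.
by apply: L1f f1; [apply: deg_lt_residual fT|apply: vanishing_residual fv].
Qed.
End Bivariate.

(** * Multiplicity in affine coordinates *)

Definition o0 : 'I_3 := ord0.
Definition o1 : 'I_3 := lift ord0 ord0.
Definition o2 : 'I_3 := lift ord0 (lift ord0 ord0).

Lemma prod3 (A : comNzRingType) (f : 'I_3 -> A) :
  \prod_(i < 3) f i = f o0 * f o1 * f o2.
Proof. by rewrite !big_ord_recl big_ord0 mulr1 mulrA. Qed.

Lemma sum3 (f : 'I_3 -> nat) : (\sum_(i < 3) f i = f o0 + f o1 + f o2)%N.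
Proof. by rewrite !big_ord_recl big_ord0 addn0 addnA. Qed.

Lemma exprDn_widen (A : comNzRingType) (x y : A) n N : (n <= N)%N ->
  (x + y) ^+ n = \sum_(k < N.+1) x ^+ (n - k) * y ^+ k *+ 'C(n, k).
Proof.
move=> nN; rewrite exprDn.
rewrite (big_ord_widen N.+1 (fun k => x ^+ (n - k) * y ^+ k *+ 'C(n, k))) //.
rewrite [RHS](bigID (fun k : 'I_N.+1 => (k < n.+1)%N)) /=.
rewrite [X in _ = _ + X]big1 ?addr0 //.
by move=> k; rewrite -leqNgt => /bin_small ->; rewrite mulr0n.
Qed.

(* The coefficient of X^k Y^l in F(1, a + X, b + Y). *)
Definition hasse (K : fieldType) (F : {mpoly K[3]}) (k l : nat) (a b : K) : K :=
  \sum_(al <- msupp F) F@_al * ('C(al o1, k) * 'C(al o2, l))%:R *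
     a ^+ (al o1 - k) * b ^+ (al o2 - l).

Section Hasse.
Variables (K : fieldType) (t : nat) (F : {mpoly K[3]}).
Hypothesis Ft : F \is t.-homog.

Lemma msupp_deg al : al \in msupp F -> (al o0 + al o1 + al o2 = t)%N.
Proof.
by move/dhomogP: Ft => H /H <- /=; rewrite mdegE sum3.
Qed.

Lemma hasse_large k l a b : (t < k)%N || (t < l)%N -> hasse F k l a b = 0.
Proof.
move=> tkl; rewrite /hasse big_seq big1 // => al /msupp_deg alt.
suff -> : ('C(al o1, k) * 'C(al o2, l) = 0)%N by rewrite mulr0 !mul0r.
by case/orP: tkl => h; [rewrite bin_small //|rewrite mulnC bin_small //]; lia.
Qed.

(** Taylor expansion of F at (1 : a : b), homogenized by powers of [h o0]. The target is general
    because it serves both the affine charts and the straightened polynomials. *)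
Lemma mmap_hasse (A : comNzRingType) (phi : {rmorphism K -> A})
    (h : 'I_3 -> A) (a b : K) (e1 e2 : A) :
  h o1 = phi a * h o0 + e1 -> h o2 = phi b * h o0 + e2 ->
  mmap phi h F = \sum_(k < t.+1) \sum_(l < t.+1)
    phi (hasse F k l a b) * h o0 ^+ (t - k - l) * e1 ^+ k * e2 ^+ l.
Proof.
move=> h1 h2; transitivity (\sum_(k < t.+1) \sum_(l < t.+1)
    \sum_(al <- msupp F) phi (F@_al * ('C(al o1, k) * 'C(al o2, l))%:R *
     a ^+ (al o1 - k) * b ^+ (al o2 - l)) *
     h o0 ^+ (t - k - l) * e1 ^+ k * e2 ^+ l); last first.
  apply: eq_bigr => k _; apply: eq_bigr => l _.
  by rewrite /hasse rmorph_sum !mulr_suml.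
under [RHS]eq_bigr => k _ do rewrite exchange_big.
rewrite exchange_big /=; apply: eq_big_seq => al alF.
have alt := msupp_deg alF.
rewrite /mmap1 prod3 h1 h2 !(@exprDn_widen _ _ _ _ t); try lia.
rewrite [h o0 ^+ al o0 * _]mulr_sumr mulr_suml mulr_sumr.
apply: eq_bigr => k _.
rewrite !mulr_sumr; apply: eq_bigr => l _.
have [kal|alk] := leqP k (al o1); last first.
  by rewrite bin_small // mul0n !mulr0n !(mulr0, mul0r) rmorph0 !mul0r.
have [lal|all] := leqP l (al o2); last first.
  have -> : 'C(al o2, l) = 0%N by rewrite bin_small.
  by rewrite muln0 !mulr0n !(mulr0, mul0r) rmorph0 !mul0r.
rewrite (_ : t - k - l = al o0 + (al o1 - k) + (al o2 - l))%N; last by lia.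
rewrite natrM !exprD !exprMn !rmorphM !rmorphXn !rmorph_nat.
by ring.
Qed.
End Hasse.

Definition order_ge (K : fieldType) (n k : nat) (G : {mpoly K[n]}) : Prop :=
  forall mon : 'X_{1..n}, (mdeg mon < k)%N -> G@_mon = 0.

Section OrderGe.
Variables (K : fieldType) (n : nat).
Implicit Types G H : {mpoly K[n]}.

Lemma order_geM k l G H : order_ge k G -> order_ge l H ->
  order_ge (k + l) (G * H).
Proof.
move=> Gk Hl mon monkl; rewrite mcoeffM big1 // => -[a b] /= /eqP monE.
have [ak|ka] := ltnP (mdeg a) k; first by rewrite Gk ?mul0r.
rewrite Hl ?mulr0 //; have := congr1 (@mdeg n) monE; rewrite mdegD; lia.
Qed.

Lemma order_geMl k G H : order_ge k G -> order_ge k (H * G).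
Proof. by move=> Gk; rewrite -[k]add0n; apply: order_geM. Qed.

Lemma order_geX G e : order_ge 1 G -> order_ge e (G ^+ e).
Proof.
move=> G1; elim: e => // e IH.
by rewrite exprS -add1n; apply: order_geM.
Qed.

Lemma order_ge_sum k (I : Type) (s : seq I) (P : pred I)
    (f : I -> {mpoly K[n]}) :
  (forall i, P i -> order_ge k (f i)) -> order_ge k (\sum_(i <- s | P i) f i).
Proof.
move=> fk mon monk; rewrite raddf_sum /= big1 // => i Pi.
exact: fk.
Qed.

Lemma order_ge_le k l G : (l <= k)%N -> order_ge k G -> order_ge l G.
Proof. by move=> lk Gk mon monl; apply: Gk; apply: leq_trans lk. Qed.

Lemma order_ge_lin (i : 'I_n) : order_ge 1 ('X_i : {mpoly K[n]}).
Proof.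
move=> mon; rewrite ltnS leqn0 mdeg_eq0 => /eqP ->.
by rewrite mcoeffX; case: eqP => // /eqP; rewrite mnm1_eq0.
Qed.

Lemma order_geD k G H : order_ge k G -> order_ge k H -> order_ge k (G + H).
Proof. by move=> Gk Hk mon monk; rewrite mcoeffD Gk // Hk // addr0. Qed.
End OrderGe.

Definition chart_shift (K : fieldType) (j i : 'I_3) : {mpoly K[2]} :=
  if unlift j i is Some k then 'X_k else 0.

Lemma order_ge_shift (K : fieldType) (j i : 'I_3) :
  order_ge 1 (chart_shift K j i).
Proof.
rewrite /chart_shift; case: unliftP => [k _|_].
  exact: order_ge_lin.
by move=> mon _; rewrite mcoeff0.
Qed.

Lemma local_eqE (K : fieldType) (F : {mpoly K[3]}) (p : P2 K) (j : 'I_3) :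
  hcoord p 0 j != 0 ->
  local_eq F p j = mmap (@mpolyC 2 K)
    (fun i => (hcoord p 0 i / hcoord p 0 j)%:MP + chart_shift K j i) F.
Proof.
move=> pj; rewrite /local_eq /comp_mpoly /mmap; apply: eq_bigr => al _.
congr (_ * _); apply: mmap1_eq => i; rewrite tnth_mktuple /chart_shift.
by case: unliftP => [k //|->]; rewrite divff // addr0.
Qed.

Lemma local_eq_hasse (K : fieldType) (t : nat) (F : {mpoly K[3]}) (p : P2 K) 
    (j : 'I_3) : F \is t.-homog ->
  hcoord p 0 o0 != 0 -> hcoord p 0 j != 0 ->
  let a := hcoord p 0 o1 / hcoord p 0 o0 in
  let b := hcoord p 0 o2 / hcoord p 0 o0 in
  local_eq F p j = \sum_(k < t.+1) \sum_(l < t.+1)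
    (hasse F k l a b)%:MP *
    ((hcoord p 0 o0 / hcoord p 0 j)%:MP + chart_shift K j o0) ^+ (t - k - l) *
    (chart_shift K j o1 - a%:MP * chart_shift K j o0) ^+ k *
    (chart_shift K j o2 - b%:MP * chart_shift K j o0) ^+ l.
Proof.
move=> Ft p0 pj a b; rewrite local_eqE //.
by apply: mmap_hasse => //; rewrite mulrDr -mpolyCM mulrA divfK //; ring.
Qed.

(** In chart 0 the Taylor coefficients are those of the local equation. In any other chart through p
    the term of index (k, l) contains k + l factors vanishing at p, so one chart controls all. *)
Lemma mult_geP (K : fieldType) (t : nat) (F : {mpoly K[3]}) (p : P2 K) m :
  F \is t.-homog -> hcoord p 0 o0 != 0 ->
  mult_ge F p m <-> forall k l, (k + l < m)%N ->
    hasse F k l (hcoord p 0 o1 / hcoord p 0 o0)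
      (hcoord p 0 o2 / hcoord p 0 o0) = 0.
Proof.
move=> Ft p0; split=> [Fp k l klm|H j pj]; last first.
  rewrite (local_eq_hasse Ft p0 pj).
  apply: order_ge_sum => k _; apply: order_ge_sum => l _.
  have [klm|mkl] := ltnP (k + l) m.
    by rewrite H // mpolyC0 !mul0r => mon _; rewrite mcoeff0.
  have shift1 i c : order_ge 1 (chart_shift K j i - c * chart_shift K j o0).
    rewrite -mulNr; apply: order_geD; first exact: order_ge_shift.
    by apply: order_geMl; apply: order_ge_shift.
  apply: (order_ge_le mkl); apply: order_geM; last exact: order_geX.
  by apply: order_geMl; apply: order_geX.
have [tkl|] := boolP ((t < k)%N || (t < l)%N).
  exact: hasse_large Ft _ _ _ _ tkl.
rewrite negb_or -!leqNgt => /andP[kt lt].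
pose X k l : 'X_{1..2} := (U_(ord0) *+ k + U_(lift ord0 ord0) *+ l)%MM.
have Xinj k1 l1 k2 l2 : (X k1 l1 == X k2 l2) = (k1 == k2) && (l1 == l2).
  apply/eqP/andP => [E|[/eqP-> /eqP->]//].
  have E0 := congr1 (fun M : 'X_{1..2} => M ord0) E.
  have E1 := congr1 (fun M : 'X_{1..2} => M (lift ord0 ord0)) E.
  move: E0 E1; rewrite /X !mnmDE !mulmnE !mnm1E /= !mul1n !mul0n !addn0 !add0n.
  by move=> -> ->.
have := Fp o0 p0 (X k l); rewrite mdegD !mdegMn !mdeg1 !mul1n => /(_ klm).
rewrite (local_eq_hasse Ft p0 p0) raddf_sum /=.
rewrite (bigD1 (Ordinal (kt : (k < t.+1)%N))) //= raddf_sum /=.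
rewrite (bigD1 (Ordinal (lt : (l < t.+1)%N))) //=.
set a := _ / _; set b := hcoord p 0 o2 / _.
have coefE k' l' : ((hasse F k' l' a b)%:MP *
    ((hcoord p 0 o0 / hcoord p 0 o0)%:MP + chart_shift K o0 o0) ^+
      (t - k' - l') *
    (chart_shift K o0 o1 - a%:MP * chart_shift K o0 o0) ^+ k' *
    (chart_shift K o0 o2 - b%:MP * chart_shift K o0 o0) ^+ l')@_(X k l) =
    hasse F k' l' a b * ((k' == k) && (l' == l))%:R.
  rewrite divff // /chart_shift unlift_none !liftK !mulr0 !subr0 addr0.
  rewrite mpolyC1 expr1n mulr1 -mulrA !mpolyXn -mpolyXD mul_mpolyC.
  by rewrite mcoeffZ mcoeffX Xinj.
rewrite coefE !eqxx mulr1 big1 ?addr0 => [|l' l'l]; last first.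
  rewrite coefE; case: eqP => [_|_]; rewrite ?mulr0 //=.
  rewrite -[(l' == l :> nat)]/(l' == Ordinal (lt : (l < t.+1)%N)).
  by rewrite (negbTE l'l) mulr0.
rewrite big1 ?addr0 // => k' k'k; rewrite raddf_sum /= big1 // => l' _.
rewrite coefE -[(k' == k :> nat)]/(k' == Ordinal (kt : (k < t.+1)%N)).
by rewrite (negbTE k'k) mulr0.
Qed.

(** * Ranks and functionals *)

(** Expressing full rank by a nonzero maximal minor makes it an open condition on the specialization
    [ev]. *)
Lemma row_free_minor (K : fieldType) (A : comNzRingType)
    (ev : {rmorphism A -> K}) N q (M : 'M[A]_(N, q)) :
  row_free (map_mx ev M) <->
  exists g : 'I_N -> 'I_q, ev (\det (mxsub id g M)) != 0.
Proof.
have map_sub (g : 'I_N -> 'I_q) :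
    \det (mxsub id g (map_mx ev M)) = ev (\det (mxsub id g M)).
  by rewrite -det_map_mx; congr (\det _); apply/matrixP => i j; rewrite !mxE.
split=> [rf|[g]].
  have rfT : row_full (map_mx ev M)^T by rewrite /row_full mxrank_tr.
  exists (fullrankfun rfT); rewrite -map_sub -det_tr trmx_mxsub.
  by have := fullrowsub_unit rfT; rewrite unitmxE unitfE.
rewrite -map_sub => dg.
apply: inj_row_free => v vM.
have U : mxsub id g (map_mx ev M) \in unitmx by rewrite unitmxE unitfE.
have : v *m mxsub id g (map_mx ev M) = 0.
  apply/matrixP => i j; have /matrixP/(_ i (g j)) := vM; rewrite !mxE.
  by apply: etrans; apply: eq_bigr => k _; rewrite !mxE.
move/(congr1 (mulmx^~ (invmx (mxsub id g (map_mx ev M))))).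
by rewrite mulmxK // mul0mx.
Qed.

Section LinearMaps.
Variables (K : fieldType) (V : vectType K) (q : nat) (psi : V -> 'rV[K]_q).
Hypothesis psi_lin : forall a u v, psi (a *: u + v) = a *: psi u + psi v.

Lemma lin_sum (I : Type) (s : seq I) (c : I -> K) (f : I -> V) :
  psi (\sum_(i <- s) c i *: f i) = \sum_(i <- s) c i *: psi (f i).
Proof.
have psi0 : psi 0 = 0.
  by have := psi_lin (-1) 0 0; rewrite scaler0 addr0 scaleN1r addNr.
elim: s => [|i s IH]; first by rewrite !big_nil.
by rewrite !big_cons psi_lin IH.
Qed.

Lemma dim_le_functionals (W : {vspace V}) :
  (forall v, v \in W -> psi v = 0 -> v = 0) -> (\dim W <= q)%N.
Proof.
move=> inj; set X := vbasis W.
pose C := \matrix_(i < \dim W) psi X`_i.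
have : row_free C.
  apply: inj_row_free => v; rewrite mulmx_sum_row => vC.
  have : \sum_i v 0 i *: X`_i = 0.
    apply: inj.
      apply: rpred_sum => i _; apply: rpredZ; apply: vbasis_mem.
      by rewrite mem_nth // size_tuple.
    by rewrite lin_sum -[RHS]vC; apply: eq_bigr => i _; rewrite rowK.
  move/(freeP (basis_free (vbasisP W))) => v0.
  by apply/rowP => i; rewrite mxE v0.
by move/eqP <-; apply: rank_leq_col.
Qed.

Lemma dim_ge_kernel (W : {vspace V}) :
  (forall v, psi v = 0 -> v \in W) -> (\dim {:V} <= \dim W + q)%N.
Proof.
move=> kerW.
pose f : {linear V -> 'rV[K]_q} := HB.pack psi
  (GRing.isLinear.Build K V 'rV[K]_q _ psi psi_lin).
have := limg_ker_dim (linfun f) fullv; rewrite capfv => <-.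
apply: leq_add.
  by apply/dimvS/subvP => v; rewrite memv_ker lfunE => /eqP /kerW.
by apply: leq_trans (dimvS (subvf _)) _; rewrite dimvf /dim /= mul1n.
Qed.

Lemma row_free_basis (B : 'M[K]_(\dim {:V}, q)) :
  (forall k : 'I_(\dim {:V}), psi (vbasis {:V})`_k = row k B) ->
  row_free B <-> (forall v, psi v = 0 -> v = 0).
Proof.
move=> psiB; set X := vbasis {:V}; split=> [rf v pv|inj].
  have vE := coord_vbasis (memvf v).
  have : (\row_i coord X i v) *m B = 0.
    rewrite mulmx_sum_row -[RHS]pv {2}vE lin_sum.
    by apply: eq_bigr => i _; rewrite mxE psiB.
  move/eqP; rewrite mulmx_free_eq0 // => /eqP /rowP v0.
  rewrite vE big1 // => i _; have := v0 i; rewrite !mxE => ->.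
  by rewrite scale0r.
apply: inj_row_free => v; rewrite mulmx_sum_row => vB.
have : \sum_i v 0 i *: X`_i = 0.
  by apply: inj; rewrite lin_sum -[RHS]vB; apply: eq_bigr => i _; rewrite psiB.
move/(freeP (basis_free (vbasisP _))) => v0.
by apply/rowP => i; rewrite mxE v0.
Qed.
End LinearMaps.

Lemma vspace_functionals (K : fieldType) (V : vectType K) (W : {vspace V}) :
  exists L : V -> 'rV[K]_(\dim W),
    (forall a u v, L (a *: u + v) = a *: L u + L v) /\
    forall v, v \in W -> L v = 0 -> v = 0.
Proof.
exists (fun v => \row_i coord (vbasis W) i (projv W v)); split=> [a u v|v vW].
  by apply/rowP => i; rewrite !mxE !linearP.
move/rowP => v0; rewrite (coord_vbasis vW) big1 // => i _.
by have := v0 i; rewrite !mxE projv_id // => ->; rewrite scale0r.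
Qed.

Lemma msupp_sum_linear (K : fieldType) n (V : lmodType K) (w : 'X_{1..n} -> V) a
    (F G : {mpoly K[n]}) :
  \sum_(al <- msupp (a *: F + G)) (a *: F + G)@_al *: w al =
  a *: (\sum_(al <- msupp F) F@_al *: w al) +
  \sum_(al <- msupp G) G@_al *: w al.
Proof.
have widen (H : {mpoly K[n]}) d : (msize H <= d)%N ->
    \sum_(al <- msupp H) H@_al *: w al =
    \sum_(al : 'X_{1..n < d}) H@_al *: w al.
  move=> Hd; rewrite (big_mksub ('X_{1..n < d} : subFinType _)) ?msupp_uniq //=.
    rewrite big_rmcond //= => j /memN_msupp_eq0 ->.
    by rewrite scale0r.
  by move=> x /msize_mdeg_lt /leq_trans; apply.
set d := maxn (maxn (msize F) (msize G)) (msize (a *: F + G)).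
rewrite !(widen _ d) ?leq_max ?leqnn ?orbT //.
rewrite scaler_sumr -big_split /=; apply: eq_bigr => al _.
by rewrite mcoeffD mcoeffZ scalerDl scalerA.
Qed.

Lemma hasse_linear (K : fieldType) a (F G : {mpoly K[3]}) k l x y :
  hasse (a *: F + G) k l x y = a * hasse F k l x y + hasse G k l x y.
Proof.
have E H : hasse H k l x y = \sum_(al <- msupp H) H@_al *:
    (('C(al o1, k) * 'C(al o2, l))%:R *
     x ^+ (al o1 - k) * y ^+ (al o2 - l) : K^o).
  by apply: eq_bigr => al _; rewrite -[RHS]/(_ * _) !mulrA.
by rewrite !E msupp_sum_linear.
Qed.

(** * Linear conditions imposed by fat points *)

Definition in_chart0 (K : fieldType) n (p : n.-tuple (P2 K)) : Prop :=
  forall i, hcoord (tnth p i) 0 o0 != 0.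

Definition fat_conditions n (m : n.-tuple nat) : seq ('I_n * nat * nat) :=
  [seq (x.1, x.2, l) |
     x <- [seq (i, k) | i <- enum 'I_n, k <- iota 0 (tnth m i)],
     l <- iota 0 (tnth m x.1 - x.2)].

Lemma mem_fat_conditions n (m : n.-tuple nat) i k l :
  ((i, k, l) \in fat_conditions m) = (k + l < tnth m i)%N.
Proof.
apply/allpairsPdep/idP => [[[i' k']] [l' [/allpairsPdep[i'' [k'' [_]]]]]|klm].
  rewrite !mem_iota /= !add0n => k''m [-> ->] l'm [-> -> ->].
  by rewrite -ltn_subRL.
exists (i, k), l; split => //.
  apply/allpairsPdep; exists i, k; rewrite mem_enum mem_iota; split => //.
  by rewrite /= add0n (leq_ltn_trans (leq_addr _ _) klm).
by rewrite mem_iota /= add0n ltn_subRL.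
Qed.

Lemma size_fat_conditions n (m : n.-tuple nat) :
  size (fat_conditions m) = (\sum_(i < n) 'C((tnth m i).+1, 2))%N.
Proof.
rewrite size_allpairs_dep sumnE big_map big_allpairs_dep /= big_enum /=.
apply: eq_bigr => i _; have := curve_dim_bin (tnth m i) (tnth m i).
rewrite subnn addn0 => <-; rewrite -{1}[tnth m i]subn0 -/(index_iota 0 _).
by rewrite big_mkord; apply: eq_bigr => k _; rewrite size_iota.
Qed.

Section FatPart.
Variables (K : fieldType) (n : nat) (m : n.-tuple nat) (p : n.-tuple (P2 K)).

(** Multiplicity conditions are stable under sums and multiples, so generating an ideal adds no new
    forms. *)
Lemma mem_fat_partE t (F : dhomog 3 K t) :
  F \in fat_part m p t <->
  forall i, mult_ge (F : {mpoly K[3]}) (tnth p i) (tnth m i).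
Proof.
rewrite mem_fat_part; split => [[s [sF FE]] i|H]; last first.
  exists [:: (1, (F : {mpoly K[3]}))]; split => [x|].
    rewrite inE => /eqP ->; split=> [|i]; last exact: H.
    by exists t; apply: dhomog_is_dhomog.
  by rewrite big_seq1 mul1r.
move=> j pj; rewrite FE /local_eq raddf_sum /= big_seq.
apply: order_ge_sum => x /sF [_ /(_ i)] xm.
by rewrite rmorphM; apply: order_geMl; apply: xm.
Qed.

Definition affx i := hcoord (tnth p i) 0 o1 / hcoord (tnth p i) 0 o0.
Definition affy i := hcoord (tnth p i) 0 o2 / hcoord (tnth p i) 0 o0.

Lemma mem_fat_part_hasse t (F : dhomog 3 K t) : in_chart0 p ->
  F \in fat_part m p t <->
  forall x, x \in fat_conditions m ->
    hasse (F : {mpoly K[3]}) x.1.2 x.2 (affx x.1.1) (affy x.1.1) = 0.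
Proof.
move=> gp; rewrite mem_fat_partE; split => [H [[i k] l]|H i].
  rewrite mem_fat_conditions => klm.
  exact: (mult_geP _ (dhomog_is_dhomog F) (gp i)).1 klm.
apply/(mult_geP _ (dhomog_is_dhomog F) (gp i)) => k l klm.
by apply: (H (i, k, l)); rewrite mem_fat_conditions.
Qed.

Lemma hilb_ge t : in_chart0 p ->
  ('C(t.+2, 2) <= hilb m p t + \sum_(i < n) 'C((tnth m i).+1, 2))%N.
Proof.
move=> gp; rewrite -size_fat_conditions.
have -> : 'C(t.+2, 2) = \dim {:dhomog 3 K t}.
  by rewrite dimvf /dim /= -[RHS]bin_sub ?leq_addr // addKn addn2.
set cs := in_tuple (fat_conditions m).
pose psi (F : dhomog 3 K t) : 'rV[K]_(size (fat_conditions m)) := \row_e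
  hasse (F : {mpoly K[3]}) (tnth cs e).1.2 (tnth cs e).2
    (affx (tnth cs e).1.1) (affy (tnth cs e).1.1).
apply: (@dim_ge_kernel _ _ _ psi) => [a F G|F /rowP F0].
  by apply/rowP => e; rewrite !mxE linearP hasse_linear.
apply/mem_fat_part_hasse => // x /(tnthP cs) [e ->].
by have := F0 e; rewrite !mxE.
Qed.
End FatPart.

(** * Degeneration along the arc *)

Lemma line_point (K : fieldType) (w : 'rV[K]_3) : w != 0 ->
  exists p : P2 K, exists2 c, c != 0 & hcoord p = c *: w.
Proof.
move=> w0; have dw : \dim <[w]>%VS == 1%N by rewrite dim_vline w0.
exists (exist _ <[w]>%VS dw); rewrite /hcoord /=.
have /vlineP[c cE] := memv_pick <[w]>%VS; exists c => //.
apply: contraNneq w0 => c0; have := vpick0 <[w]>%VS.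
by rewrite cE c0 scale0r eqxx -memv0 => /esym /eqP <-; rewrite memv_line.
Qed.

Section Dehomogenize.
Variable K : numFieldType.

Definition polyCC : {rmorphism K -> {poly {poly K}}} := (@polyC _ \o @polyC K).

Definition affine_coords (y : {poly {poly K}}) (i : 'I_3) : {poly {poly K}} :=
  if unlift o0 i is Some k then (if k == ord0 then 'X%:P else y) else 1.

Lemma affine_coords0 y : affine_coords y o0 = 1.
Proof. by rewrite /affine_coords unlift_none. Qed.
Lemma affine_coords1 y : affine_coords y o1 = 'X%:P.
Proof. by rewrite /affine_coords liftK. Qed.
Lemma affine_coords2 y : affine_coords y o2 = y.
Proof. by rewrite /affine_coords liftK. Qed.

Definition dehom (F : {mpoly K[3]}) : {poly {poly K}} :=
  mmap polyCC (affine_coords 'X) F.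

Lemma dehomE F : dehom F = \sum_(al <- msupp F)
  (F@_al *: 'X^(al o1))%:P * 'X^(al o2).
Proof.
apply: eq_bigr => al _; rewrite /mmap1 prod3 affine_coords0 affine_coords1.
by rewrite affine_coords2 expr1n mul1r mulrA -polyC_exp /= -polyCM -mul_polyC.
Qed.

Lemma dehom_coef F i j : (dehom F)`_j`_i =
  \sum_(al <- msupp F | (al o1 == i) && (al o2 == j)) F@_al.
Proof.
rewrite dehomE !coef_sum [RHS]big_mkcond; apply: eq_bigr => al _.
rewrite coefCM coefXn [j == _]eq_sym; case: (_ == j); last first.
  by rewrite mulr0 coef0 andbF.
rewrite mulr1 coefZ coefXn [i == _]eq_sym andbT.
by case: (_ == i); rewrite ?mulr1 ?mulr0.
Qed.

Lemma dehom_deg_lt t F : F \is t.-homog -> deg_lt t.+1 (dehom F).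
Proof.
move=> Ft i j tij; rewrite dehom_coef big_seq_cond big1 // => al.
by case/and3P => /(msupp_deg Ft) alt /eqP ali /eqP alj; lia.
Qed.

Lemma dehom_inj t F : F \is t.-homog -> dehom F = 0 -> F = 0.
Proof.
move=> Ft F0; apply/mpolyP => al; rewrite mcoeff0.
have [alF|/memN_msupp_eq0 //] := boolP (al \in msupp F).
have := dehom_coef F (al o1) (al o2); rewrite F0 !coef0.
rewrite big_mkcond (bigD1_seq al) ?msupp_uniq //= !eqxx /=.
rewrite big1_seq ?addr0 // => be /andP[beal /(msupp_deg Ft) bet].
case: ifP => // /andP[/eqP be1 /eqP be2]; case/eqP: beal; apply/mnmP => i.
have := msupp_deg Ft alF => alt.
have be0 : be o0 = al o0 by lia.
case: (unliftP o0 i) => [i' ->|->] //.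
by case: (unliftP ord0 i') => [i'' ->|->] //; rewrite (ord1 i'').
Qed.

Lemma dehom_linear a F G : dehom (a *: F + G) = a%:P *: dehom F + dehom G.
Proof. by rewrite /dehom mmapD mmapZ -mul_polyC. Qed.

Lemma straighten_dehom d r F :
  straighten d r (dehom F) =
  mmap polyCC (affine_coords ('X + (arc_poly K d r)%:P)) F.
Proof.
rewrite /straighten /dehom /mmap rmorph_sum; apply: eq_bigr => al _.
rewrite rmorphM /= comp_polyC /mmap1 !prod3 !affine_coords0 !affine_coords1.
by rewrite !affine_coords2 !rmorphM !rmorphXn /= !comp_polyC comp_polyX.
Qed.

Definition order_at (x : K) k (g : {poly {poly K}}) : Prop :=
  forall j, ('X - x%:P) ^+ (k - j) %| g`_j.

Lemma order_atM x k l g h : order_at x k g -> order_at x l h ->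
  order_at x (k + l) (g * h).
Proof.
move=> gk hl j; rewrite coefM; apply: (big_ind (fun p => _ %| p)).
- exact: dvdp0.
- by move=> a b; apply: dvdp_add.
move=> i _; have := dvdp_mul (gk i) (hl (j - i)%N).
rewrite -exprD; apply: dvdp_trans; apply: dvdp_exp2l.
by have := ltn_ord i; lia.
Qed.

Lemma order_at0 x g : order_at x 0 g.
Proof. by move=> j; rewrite sub0n dvd1p. Qed.

Lemma order_atX x g e : order_at x 1 g -> order_at x e (g ^+ e).
Proof.
move=> g1; elim: e => [|e IH]; first exact: order_at0.
by rewrite exprS -add1n; apply: order_atM.
Qed.

Lemma order_at_sum x k (I : Type) (s : seq I) (P : pred I) f :
  (forall i, P i -> order_at x k (f i)) ->
  order_at x k (\sum_(i <- s | P i) f i).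
Proof.
move=> fk j; rewrite coef_sum; apply: (big_ind (fun p => _ %| p)).
- exact: dvdp0.
- by move=> a b; apply: dvdp_add.
by move=> i /fk.
Qed.

Lemma order_at_le x k l g : (l <= k)%N -> order_at x k g -> order_at x l g.
Proof.
by move=> lk gk j; apply: dvdp_trans (gk j); apply/dvdp_exp2l/leq_sub2r.
Qed.

Lemma mult_order_at d r t F (p : P2 K) k : F \is t.-homog ->
  hcoord p 0 o0 != 0 ->
  let x := hcoord p 0 o1 / hcoord p 0 o0 in
  hcoord p 0 o2 / hcoord p 0 o0 = (arc_poly K d r).[x] ->
  mult_ge F p k -> order_at x k (straighten d r (dehom F)).
Proof.
move=> Ft p0 x yE /(mult_geP _ Ft p0) Fk; rewrite straighten_dehom.
set y := _ / _ in yE Fk; rewrite -/x in Fk.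
rewrite (@mmap_hasse _ t F Ft _ polyCC _ x y ('X - x%:P)%:P
  ('X + (arc_poly K d r - y%:P)%:P)); first last.
- by rewrite affine_coords0 affine_coords2 mulr1 /= polyCB; ring.
- by rewrite affine_coords0 affine_coords1 mulr1 /= -polyCD; congr _%:P; ring.
apply: order_at_sum => a _; apply: order_at_sum => b _.
have [abk|kab] := ltnP (a + b) k.
  by rewrite Fk //= !polyC0 !mul0r => j; rewrite coef0 dvdp0.
apply: (order_at_le kab); apply: order_atM.
  rewrite -[X in order_at _ X]add0n; apply: order_atM; first exact: order_at0.
  apply: order_atX => j; rewrite coefC.
  by case: j => [|j]; rewrite ?subn0 ?dvdp0.
apply: order_atX => j; rewrite coefD coefX coefC; case: j => [|j] /=.
  by rewrite add0r expr1 dvdp_XsubCl rootE hornerD hornerN hornerC yE subrr.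
by rewrite subSS sub0n dvd1p.
Qed.
End Dehomogenize.

Lemma poly_nonroot (K : numFieldType) (p : {poly K}) : p != 0 ->
  exists n : nat, p.[n.+1%:R] != 0.
Proof.
move=> p0; apply: contrapT => H.
pose rs : seq K := [seq i.+1%:R | i <- iota 0 (size p)].
have /max_poly_roots : p != 0 := p0.
move=> /(_ rs); rewrite size_map size_iota ltnn => /(_ _ _)/negP; apply.
- apply/allP => x /mapP[i _ ->]; apply/rootP/eqP/negPn/negP => pi.
  by apply: H; exists i.
- rewrite map_inj_uniq ?iota_uniq // => i j /eqP.
  by rewrite eqr_nat => /eqP[].
- by [].
Qed.

Lemma dvdp_prod_XsubC (K : fieldType) n (a : 'I_n -> K) (e : 'I_n -> nat)
    (g : {poly K}) : injective a ->
  (forall i, ('X - (a i)%:P) ^+ e i %| g) ->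
  \prod_(i < n) ('X - (a i)%:P) ^+ e i %| g.
Proof.
move=> ainj dvg; have := index_enum_uniq 'I_n.
elim: (index_enum _) => [|i s IH]; first by rewrite big_nil dvd1p.
rewrite big_cons => /andP[is_ us]; rewrite Gauss_dvdp ?dvg ?IH //.
apply: coprimep_expl; rewrite coprimep_sym coprimep_XsubC rootE horner_prod.
rewrite prodf_seq_neq0; apply/allP => j js /=.
rewrite horner_exp hornerXsubC expf_neq0 // subr_eq0.
by apply: contraNneq is_ => /ainj ->.
Qed.

Lemma map_rmodp (K : fieldType) (A : comNzRingType) (ev : {rmorphism A -> K})
    (G Q : {poly A}) : Q \is monic ->
  map_poly ev (Pdiv.CommonRing.rmodp G Q) =
  Pdiv.CommonRing.rmodp (map_poly ev G) (map_poly ev Q).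
Proof.
move=> mQ; have mQ' : map_poly ev Q \is monic by apply: monic_map.
rewrite {2}(Pdiv.RingMonic.rdivp_eq mQ G) rmorphD rmorphM /=.
rewrite Pdiv.RingMonic.rmodp_addl_mul_small //.
apply: leq_ltn_trans (size_poly _ _) _.
rewrite size_map_poly_id0; last by rewrite (monicP mQ) rmorph1 oner_neq0.
by rewrite Pdiv.CommonRing.ltn_rmodp monic_neq0.
Qed.

Definition col_sum n (m : n.-tuple nat) (j : nat) : nat :=
  (\sum_(i < n) (tnth m i - j))%N.

Section Special.
Variables (K : numFieldType) (n : nat) (m : n.-tuple nat) (d r t : nat).

Local Notation V := (dhomog 3 K t).
Local Notation s := (col_sum m 0).

(* Inner variable eps, outer variable x: prod_i (x - (1 + i eps))^(m_i - j). *)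
Definition moving_modulus (j : nat) : {poly {poly K}} :=
  \prod_(i < n) ('X - (1 + (i : nat)%:R *: 'X)%:P) ^+ (tnth m i - j).

Definition modulus (e : K) (j : nat) : {poly K} :=
  \prod_(i < n) ('X - (1 + (i : nat)%:R * e)%:P) ^+ (tnth m i - j).

Lemma moving_modulus_monic j : moving_modulus j \is monic.
Proof. by apply: monic_prod => i _; apply/monic_exp/monicXsubC. Qed.

Lemma modulus_monic e j : modulus e j \is monic.
Proof. by apply: monic_prod => i _; apply/monic_exp/monicXsubC. Qed.

Lemma map_moving_modulus e j :
  map_poly (horner_eval e) (moving_modulus j) = modulus e j.
Proof.
rewrite rmorph_prod; apply: eq_bigr => i _.
rewrite rmorphXn rmorphB /= map_polyX map_polyC /= horner_evalE.
by rewrite hornerD hornerC hornerZ hornerX.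
Qed.

Lemma modulus0 j : modulus 0 j = ('X - 1%:P) ^+ col_sum m j.
Proof.
by rewrite expr_sum; apply: eq_bigr => i _; rewrite mulr0 addr0.
Qed.

Lemma size_modulus e j : size (modulus e j) = (col_sum m j).+1.
Proof.
rewrite /modulus /col_sum; elim: (index_enum _) => [|i S IH].
  by rewrite !big_nil size_poly1.
rewrite !big_cons size_monicM; first last.
- by apply/monic_neq0/monic_prod => k _; apply/monic_exp/monicXsubC.
- exact/monic_exp/monicXsubC.
by rewrite size_exp_XsubC IH addSn addnS.
Qed.

Lemma col_sum_le j : (col_sum m j <= s)%N.
Proof. by apply: leq_sum => i _; apply: leq_sub2l. Qed.

Lemma col_sum_eq0 j : (s <= j)%N -> col_sum m j = 0%N.
Proof.
move=> sj; rewrite /col_sum big1 // => i _; apply/eqP; rewrite subn_eq0.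
apply: leq_trans sj; rewrite /col_sum (bigD1 i) //= subn0.
exact: leq_addr.
Qed.

Local Notation idx := ('I_s * 'I_s)%type.

(** Division by a monic polynomial commutes with specializing eps, so these coefficients are
    polynomial in eps. Indices below M_n suffice: for j >= M_n the modulus is 1, and every remainder
    has degree < M_n. *)
Definition remainder_coef (A : nzRingType) (Q : nat -> {poly A})
    (g : nat -> {poly A}) (c : 'I_#|{: idx}|) : A :=
  let jl : idx := enum_val c in (Pdiv.CommonRing.rmodp (g jl.1) (Q jl.1))`_jl.2.

Definition remainders (e : K) (g : {poly {poly K}}) : 'rV[K]_#|{: idx}| :=
  \row_c remainder_coef (modulus e) (fun j => g`_j) c.

Lemma remainders_linear e a f g :
  remainders e (a%:P *: f + g) = a *: remainders e f + remainders e g.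
Proof.
apply/rowP => c; rewrite !mxE /remainder_coef coefD coefZ mul_polyC.
rewrite Pdiv.RingMonic.rmodpD ?modulus_monic //.
by rewrite Pdiv.RingMonic.rmodpZ ?modulus_monic // coefD coefZ.
Qed.

Lemma remainders_eq0 e g :
  remainders e g = 0 <-> forall j, modulus e j %| g`_j.
Proof.
split => [/rowP g0 j|dvg]; last first.
  apply/rowP => c; rewrite !mxE /remainder_coef.
  move: (enum_val c) => -[j l] /=.
  have := dvg j; rewrite dvdpE => /Pdiv.CommonRing.rmodp_eq0 ->.
  by rewrite coef0.
have [sj|js] := leqP s j.
  suff -> : modulus e j = 1 by rewrite dvd1p.
  by rewrite /modulus big1 // => i _; move: (col_sum_eq0 sj) => /eqP;
    rewrite /col_sum sum_nat_eq0 => /forallP/(_ i)/eqP ->.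
rewrite dvdpE; apply/Pdiv.CommonRing.rmodp_eq0P/polyP => l; rewrite coef0.
have [sl|ls] := leqP s l.
  apply: nth_default; apply: leq_trans sl; apply: leq_trans (col_sum_le j).
  rewrite -ltnS -(size_modulus e j) Pdiv.CommonRing.ltn_rmodp.
  exact/monic_neq0/modulus_monic.
have := g0 (enum_rank (Ordinal js, Ordinal ls)).
by rewrite !mxE /remainder_coef enum_rankK.
Qed.

Lemma modulus_inj (e : K) : e != 0 ->
  injective (fun i : 'I_n => 1 + (i : nat)%:R * e).
Proof.
move=> e0 i j /addrI /(mulIf e0) /eqP; rewrite eqr_nat => /eqP.
exact: val_inj.
Qed.

(* The fat points at the n points of abscissa 1 + i eps of the arc degenerate,
   as eps tends to 0, to the ideal of the y^j (x - 1)^(c_j), where y vanishes on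
   the arc; the Hilbert function can only jump up in the limit. *)
Lemma special_position J k : (0 < d)%N -> drops r (col_sum m) ->
  exists2 p : n.-tuple (P2 K), in_chart0 p &
    (hilb m p t <= hbound d r J k t.+1 (col_sum m))%N.
Proof.
move=> d0 drp; have [L Llin Linj] := limit_functionals K J d0 drp k t.+1.
set h := hbound _ _ _ _ _ _ in L Llin Linj *.
pose st (F : V) := straighten d r (dehom (F : {mpoly K[3]})).
have stlin a F G : st (a *: F + G) = a%:P *: st F + st G.
  by rewrite /st linearP /= dehom_linear /straighten comp_polyD comp_polyZ.
(* The remainders vanish on the forms through the fat points at parameter e, so injectivity of
   [psi e] bounds their dimension by h. At e = 0 they express membership in I_c, and injectivity
   comes from [limit_functionals]. *)
pose psi e (F : V) : 'rV[K]_(h + #|{: idx}|) :=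
  row_mx (L (dehom (F : {mpoly K[3]}))) (remainders e (st F)).
have psilin e a F G : psi e (a *: F + G) = a *: psi e F + psi e G.
  rewrite /psi stlin remainders_linear linearP /= dehom_linear Llin.
  by rewrite scale_row_mx add_row_mx.
pose b (i : 'I_(\dim {:V})) : V := (vbasis {:V})`_i.
pose M : 'M[{poly K}]_(\dim {:V}, h + #|{: idx}|) := row_mx
  (\matrix_(i, c) (L (dehom (b i : {mpoly K[3]})) 0 c)%:P)
  (\matrix_(i, c) remainder_coef moving_modulus
     (fun j => map_poly polyC (st (b i))`_j) c).
have psiM e i : psi e (b i) = row i (map_mx (horner_eval e) M).
  rewrite /psi /M map_row_mx; apply/rowP => c; rewrite !mxE.
  case: split_ordP => c' _; rewrite !mxE /= horner_evalE ?hornerC //.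
  rewrite /remainder_coef -[RHS](coef_map (horner_eval e)) /=.
  rewrite map_rmodp ?moving_modulus_monic // map_moving_modulus.
  rewrite -map_poly_comp map_poly_id // => x _ /=.
  by rewrite horner_evalE hornerC.
have psi0 F : psi 0 F = 0 -> F = 0.
  move=> pF.
  have /eq_row_mx[LF /remainders_eq0 vF] : psi 0 F = row_mx 0 0.
    by rewrite row_mx0.
  apply: val_inj; apply: (dehom_inj (dhomog_is_dhomog F)).
  apply: Linj LF; first exact/dehom_deg_lt/dhomog_is_dhomog.
  by move=> j; rewrite -modulus0.
have [g /= dg] : exists g, horner_eval 0 (\det (mxsub id g M)) != 0.
  by apply/row_free_minor/(row_free_basis (psilin 0) (psiM 0)).
(* The minor is a polynomial in eps that is nonzero at 0, hence nonzero at some positive integer.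
   Taking that integer as eps makes the abscissas distinct. *)
have [|l dl] := @poly_nonroot _ (\det (mxsub id g M)).
  by apply: contraNneq dg => ->; rewrite horner_evalE horner0.
set e := l.+1%:R in dl; have e0 : e != 0 by rewrite pnatr_eq0.
have psie : forall F, psi e F = 0 -> F = 0.
  by apply/(row_free_basis (psilin e) (psiM e))/row_free_minor; exists g.
pose x i := 1 + (i : nat)%:R * e.
have /fin_all_exists [P PE] (i : 'I_n) : exists p : P2 K, exists2 c, c != 0 &
    [/\ hcoord p 0 o0 = c, hcoord p 0 o1 = c * x i &
       hcoord p 0 o2 = c * (arc_poly K d r).[x i]].
  pose w : 'rV[K]_3 := \row_j if unlift o0 j is Some j' then
    (if j' == ord0 then x i else (arc_poly K d r).[x i]) else 1.
  have w0 : w 0 o0 = 1 by rewrite mxE unlift_none.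
  have [|p [c c0 pE]] := @line_point _ w.
    by apply: contra_neq (oner_neq0 K) => wE; rewrite -w0 wE mxE.
  exists p, c => //; rewrite pE ![(c *: w) _ _]mxE w0 mulr1; split => //.
    by rewrite mxE liftK.
  by rewrite mxE liftK.
pose p := [tuple P i | i < n].
have gp : in_chart0 p.
  by move=> i; rewrite tnth_mktuple; have [c c0 [-> _ _]] := PE i.
exists p => //.
apply: (@dim_le_functionals _ _ _ (fun F : V => L (dehom (F : {mpoly K[3]})))).
  by move=> a F G; rewrite linearP /= dehom_linear Llin.
move=> F /mem_fat_partE Fp LF; apply: psie.
rewrite /psi LF (_ : remainders e (st F) = 0) ?row_mx0 //.
apply/remainders_eq0 => j; apply: dvdp_prod_XsubC; first exact: modulus_inj.
move=> i; have [c c0 [p0 p1 p2]] := PE i.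
have := Fp i; rewrite tnth_mktuple => Fi.
have pi0 : hcoord (P i) 0 o0 != 0 by rewrite p0.
have := mult_order_at (d := d) (r := r) (dhomog_is_dhomog F) pi0 _ Fi.
rewrite p0 p1 p2 ![c * _ / _]mulrAC divff // !mul1r => /(_ erefl j).
by [].
Qed.
End Special.

(** * Semicontinuity in the points *)

Section Multihomogeneous.
Variables (K : fieldType) (n : nat).
Implicit Types (f g : {mpoly K[n * 3]}) (e : 'I_n -> nat).

Definition multideg (e : 'I_n -> nat) f : Prop :=
  forall mon, mon \in msupp f ->
    forall i : 'I_n, (\sum_(j < 3) mon (mxvec_index i j))%N = e i.

Lemma multideg_ext e e' f : multideg e f -> e =1 e' -> multideg e' f.
Proof. by move=> fe ee' mon monf i; rewrite -ee' fe. Qed.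

Lemma multideg0 e : multideg e 0.
Proof. by move=> mon; rewrite msupp0. Qed.

Lemma multidegD e f g : multideg e f -> multideg e g -> multideg e (f + g).
Proof.
by move=> fe ge mon /msuppD_le; rewrite mem_cat => /orP[/fe|/ge].
Qed.

Lemma multidegZ e c f : multideg e f -> multideg e (c *: f).
Proof. by move=> fe mon /msuppZ_le /fe. Qed.

Lemma multidegN e f : multideg e f -> multideg e (- f).
Proof. by rewrite -scaleN1r; apply: multidegZ. Qed.

Lemma multideg_sum e (I : Type) (s : seq I) (P : pred I) F :
  (forall i, P i -> multideg e (F i)) -> multideg e (\sum_(i <- s | P i) F i).
Proof.
move=> Fe; apply: big_ind => //; first exact: multideg0.
by move=> f g; apply: multidegD.
Qed.

Lemma multidegM e e' f g : multideg e f -> multideg e' g ->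
  multideg (fun i => e i + e' i)%N (f * g).
Proof.
move=> fe ge mon /msuppM_le /allpairsP[[a b] /= [/fe ae /ge be ->]] i.
by rewrite -ae -be -big_split; apply: eq_bigr => j _; rewrite mnmDE.
Qed.

Lemma multidegC (c : K) : multideg (fun=> 0%N) c%:MP.
Proof.
move=> mon; rewrite msuppC; case: eqP => // _; rewrite inE => /eqP -> i.
by rewrite big1 // => j _; rewrite mnm0E.
Qed.

Lemma multideg_prod (I : Type) (s : seq I) (E : I -> 'I_n -> nat) F :
  (forall i, multideg (E i) (F i)) ->
  multideg (fun i => \sum_(x <- s) E x i)%N (\prod_(x <- s) F x).
Proof.
move=> FE; elim: s => [|x s IH].
  rewrite big_nil -mpolyC1; apply: (multideg_ext (@multidegC 1)) => i.
  by rewrite big_nil.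
rewrite big_cons; apply: (multideg_ext (multidegM (FE x) IH)) => i.
by rewrite big_cons.
Qed.

Lemma multidegXn i j k :
  multideg (fun i' => (i == i') * k)%N ('X_(mxvec_index i j) ^+ k).
Proof.
have X1 : multideg (fun i' => i == i' : nat) ('X_(mxvec_index i j)).
  move=> mon; rewrite msuppX inE => /eqP -> i'.
  under eq_bigr do rewrite mnm1E.
  have inj a b : (mxvec_index i j == mxvec_index a b) = (i == a) && (j == b).
    have injm : injective (uncurry (@mxvec_index n 3)).
      by have [h hK _] := curry_mxvec_bij n 3 => x y E; rewrite -[x]hK // E hK.
    by rewrite -[LHS]/(uncurry _ (i, j) == uncurry _ (a, b)) (inj_eq injm).
  under eq_bigr do rewrite inj.
  case: (i == i') => /=; last by rewrite big1.
  rewrite (bigD1 j) //= eqxx big1 ?addn0 // => l.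
  by rewrite eq_sym => /negbTE ->.
elim: k => [|k IH].
  rewrite expr0 -mpolyC1; apply: (multideg_ext (@multidegC 1)) => i'.
  by rewrite muln0.
rewrite exprS; apply: (multideg_ext (multidegM X1 IH)) => i'.
by rewrite mulnS.
Qed.

Lemma multideg_det N (A : 'M[{mpoly K[n * 3]}]_N) (E : 'I_N -> 'I_n -> nat) :
  (forall i c, multideg (E c) (A i c)) ->
  multideg (fun i => \sum_c E c i)%N (\det A).
Proof.
move=> AE; apply: multideg_sum => s _; rewrite mulr_sign.
have sE : multideg (fun i => \sum_c E c i)%N (\prod_i A i (s i)).
  apply: (multideg_ext (@multideg_prod _ _ _ _ (fun i => AE i (s i)))) => i.
  by rewrite [RHS](reindex_inj (@perm_inj _ s)).
by case: ifP => // _; apply: multidegN.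
Qed.

Lemma prod_mxvec (F : 'I_(n * 3) -> K) :
  \prod_k F k = \prod_i \prod_(j < 3) F (mxvec_index i j).
Proof.
rewrite pair_bigA /= (reindex _ (curry_mxvec_bij n 3)).
by apply: eq_bigr => -[i j].
Qed.

(** Changing the representatives of the points multiplies the value by a product of powers of the
    scaling factors, so nonvanishing depends on the points alone when these are nonzero. *)
Lemma multideg_scale e f (c : 'I_n -> K) (v w : 'I_(n * 3) -> K) :
  multideg e f ->
  (forall i j, w (mxvec_index i j) = c i * v (mxvec_index i j)) ->
  f.@[w] = (\prod_i c i ^+ e i) * f.@[v].
Proof.
move=> fe wE; rewrite !mevalE mulr_sumr; apply: eq_big_seq => mon /fe mone.
rewrite mulrCA; congr (_ * _); rewrite !prod_mxvec -big_split /=.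
apply: eq_bigr => i _; rewrite -mone expr_sum -big_split /=.
by apply: eq_bigr => j _; rewrite wE exprMn.
Qed.
End Multihomogeneous.

Lemma meval_line (K : fieldType) N (f : {mpoly K[N]}) (v w : 'I_N -> K) :
  exists P : {poly K}, forall z, P.[z] = f.@[fun k => v k + (w k - v k) * z].
Proof.
exists (mmap (@polyC K) (fun k => (v k)%:P + (w k - v k)%:P * 'X) f) => z.
rewrite mevalE /mmap horner_sum; apply: eq_bigr => mon _.
rewrite hornerM hornerC /mmap1 horner_prod; congr (_ * _).
by apply: eq_bigr => k _; rewrite horner_exp !hornerE.
Qed.

(** On the line joining two points of nonvanishing both factors restrict to nonzero univariate
    polynomials, and some positive integer is a root of neither. *)
Lemma nonvanishing_prod (K : numFieldType) N (I : eqType) (s : seq I)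
    (F : I -> {mpoly K[N]}) :
  (forall i, i \in s -> exists v, (F i).@[v] != 0) ->
  exists v, (\prod_(i <- s) F i).@[v] != 0.
Proof.
elim: s => [|i s IH] Fs.
  by exists (fun=> 0); rewrite big_nil meval1 oner_neq0.
have [v vF] := Fs i (mem_head _ _).
have [|w wF] := IH; first by move=> j js; apply: Fs; rewrite inE js orbT.
have [P PE] := meval_line (F i) v w.
have [Q QE] := meval_line (\prod_(j <- s) F j) v w.
have P0 : P != 0.
  apply: contraNneq vF => P0; rewrite -(horner0 0) -P0 PE.
  by apply/eqP/meval_eq => k; rewrite mulr0 addr0.
have Q0 : Q != 0.
  apply: contraNneq wF => Q0; rewrite -(horner0 1) -Q0 QE.
  by apply/eqP/meval_eq => k; rewrite mulr1 addrC subrK.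
have [z] := poly_nonroot (mulf_neq0 P0 Q0).
rewrite hornerM PE QE -mevalM => zPQ.
by eexists; rewrite big_cons; apply: zPQ.
Qed.

Section Semicontinuity.
Variables (K : fieldType) (n : nat) (m : n.-tuple nat) (t : nat).
Local Notation V := (dhomog 3 K t).

Definition coords (p : n.-tuple (P2 K)) : 'I_(n * 3) -> K :=
  fun k => mxvec (\matrix_(i < n, j < 3) hcoord (tnth p i) 0 j) 0 k.

Lemma coordsE p i j : coords p (mxvec_index i j) = hcoord (tnth p i) 0 j.
Proof. by rewrite /coords mxvecE mxE. Qed.

(** [hasse] at the i-th point with denominators cleared, so that it is homogeneous in the
    coordinates of that point. *)
Definition hasse_mpoly (F : {mpoly K[3]}) (x : 'I_n * nat * nat) :
    {mpoly K[n * 3]} :=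
  let: (i, k, l) := x in
  \sum_(al <- msupp F) F@_al *: (('C(al o1, k) * 'C(al o2, l))%:R *:
    ('X_(mxvec_index i o0) ^+ al o0 * 'X_(mxvec_index i o1) ^+ (al o1 - k) *
     'X_(mxvec_index i o2) ^+ (al o2 - l))).

Lemma hasse_mpoly_multideg F i k l : F \is t.-homog ->
  multideg (fun i' => (i == i') * (t - k - l))%N (hasse_mpoly F (i, k, l)).
Proof.
move=> Ft; rewrite /hasse_mpoly big_seq.
apply: multideg_sum => al /(msupp_deg Ft) alt.
apply: multidegZ.
have [kal|alk] := leqP k (al o1); last first.
  by rewrite bin_small // mul0n scale0r; apply: multideg0.
have [lal|all] := leqP l (al o2); last first.
  by rewrite ['C(al o2, l)]bin_small // muln0 scale0r; apply: multideg0.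
apply: multidegZ; apply: (multideg_ext (multidegM
  (multidegM (@multidegXn _ _ _ _ _) (@multidegXn _ _ _ _ _))
  (@multidegXn _ _ _ _ _))).
by move=> i' /=; rewrite -!mulnDr; congr (_ * _)%N; lia.
Qed.

Lemma hasse_mpoly_eval F p i k l : F \is t.-homog -> in_chart0 p ->
  (hasse_mpoly F (i, k, l)).@[coords p] = 0 <->
  hasse F k l (affx p i) (affy p i) = 0.
Proof.
move=> Ft gp; set v := hcoord (tnth p i).
have v0 : v 0 o0 != 0 := gp i.
suff E : v 0 o0 ^+ t * hasse F k l (affx p i) (affy p i) =
    v 0 o0 ^+ (k + l) * (hasse_mpoly F (i, k, l)).@[coords p].
  have vX e : v 0 o0 ^+ e != 0 by rewrite expf_neq0.
  split=> H; [apply: (mulfI (vX t))|apply: (mulfI (vX (k + l)%N))].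
    by rewrite E H !mulr0.
  by rewrite -E H !mulr0.
rewrite /hasse_mpoly /hasse raddf_sum !mulr_sumr; apply: eq_big_seq => al.
move=> /(msupp_deg Ft) alt.
rewrite /= !mevalZ !mevalM !rmorphXn /= !mevalXU !coordsE -/v /affx /affy -/v.
have [kal|alk] := leqP k (al o1); last first.
  by rewrite bin_small // mul0n !(mulr0, mul0r).
have [lal|all] := leqP l (al o2); last first.
  by rewrite ['C(al o2, l)]bin_small // muln0 !(mulr0, mul0r).
have -> : (t = al o0 + (al o1 - k) + (al o2 - l) + (k + l))%N by lia.
rewrite !exprMn !exprVn !exprD.
set a := (al o1 - k)%N; set b := (al o2 - l)%N.
have va : v 0 o0 ^+ a != 0 by rewrite expf_neq0.
have vb : v 0 o0 ^+ b != 0 by rewrite expf_neq0.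
by field; rewrite va vb.
Qed.
Lemma hasse_mpoly_linear a F G x :
  hasse_mpoly (a *: F + G) x = a *: hasse_mpoly F x + hasse_mpoly G x.
Proof. by case: x => [[i k] l]; rewrite /hasse_mpoly msupp_sum_linear. Qed.

(* A maximal minor that is nonzero at p0 certifies that the forms through the
   fat points p are determined by the hilb m p0 t functionals L. *)
Lemma hilb_semicontinuous (p0 : n.-tuple (P2 K)) : in_chart0 p0 ->
  exists2 f : {mpoly K[n * 3]}, (exists e, multideg e f) &
    eval_points f p0 != 0 /\
    forall p, in_chart0 p -> eval_points f p != 0 ->
      (hilb m p t <= hilb m p0 t)%N.
Proof.
move=> gp0; have [L [Llin Linj]] := vspace_functionals (fat_part m p0 t).
rewrite -/(hilb m p0 t) in L Llin Linj *; set h := hilb m p0 t in L Llin Linj *.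
set cs := in_tuple (fat_conditions m); set q := size (fat_conditions m) in cs *.
pose psi p (F : V) : 'rV[K]_(h + q) := row_mx (L F)
  (\row_c (hasse_mpoly (F : {mpoly K[3]}) (tnth cs c)).@[coords p]).
have psilin p a F G : psi p (a *: F + G) = a *: psi p F + psi p G.
  rewrite /psi Llin scale_row_mx add_row_mx; congr row_mx.
  by apply/rowP => c; rewrite !mxE linearP hasse_mpoly_linear mevalD mevalZ.
pose b (i : 'I_(\dim {:V})) : V := (vbasis {:V})`_i.
pose M : 'M[{mpoly K[n * 3]}]_(\dim {:V}, h + q) := row_mx
  (\matrix_(i, c) (L (b i) 0 c)%:MP)
  (\matrix_(i, c) hasse_mpoly (b i : {mpoly K[3]}) (tnth cs c)).
have psiM p i : psi p (b i) = row i (map_mx (meval (coords p)) M).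
  rewrite /psi /M map_row_mx; apply/rowP => c; rewrite !mxE.
  by case: split_ordP => c' _; rewrite !mxE /= ?mevalC.
have psi_fat p F : in_chart0 p ->
    psi p F = 0 <-> L F = 0 /\ F \in fat_part m p t.
  move=> gp; have Ft := dhomog_is_dhomog F.
  split => [pF|[LF /(mem_fat_part_hasse _ _ gp) Fp]].
    have /eq_row_mx[LF /rowP F0] : psi p F = row_mx 0 0 by rewrite row_mx0.
    split => //; apply/(mem_fat_part_hasse _ _ gp) => x /(tnthP cs)[c ->].
    have := F0 c; rewrite !mxE; case: (tnth cs c) => -[i k] l.
    by move/(hasse_mpoly_eval _ _ _ Ft gp).
  rewrite /psi LF -[RHS]row_mx0; congr row_mx; apply/rowP => c; rewrite !mxE.
  have := Fp _ (mem_tnth c cs); case: (tnth cs c) => -[i k] l /= H.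
  by apply/(hasse_mpoly_eval _ _ _ Ft gp).
have [g /= dg] : exists g, (\det (mxsub id g M)).@[coords p0] != 0.
  apply/(row_free_minor (meval (coords p0))).
  apply/(row_free_basis (psilin p0) (psiM p0)).
  by move=> F /(psi_fat _ _ gp0)[LF Fp]; apply: Linj.
exists (\det (mxsub id g M)).
  (* Columns coming from L are constant; the column of a condition (i, k, l) has degree t - k - l in
     the i-th point and 0 in the others. *)
  pose E (c : 'I_(h + q)) : 'I_n -> nat := if split c is inr c' then
    fun i => (((tnth cs c').1.1 == i) *
      (t - (tnth cs c').1.2 - (tnth cs c').2))%N
    else fun=> 0%N.
  exists (fun i => \sum_c E (g c) i)%N.
  apply: (multideg_det (E := E \o g)) => i c.
  rewrite !mxE /= /E; case: (split (g c)) => c'; rewrite !mxE.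
    exact: multidegC.
  have := @hasse_mpoly_multideg (b i) (tnth cs c').1.1 (tnth cs c').1.2
    (tnth cs c').2 (dhomog_is_dhomog (b i)).
  by case: (tnth cs c') => -[].
split => [//|p gp dp].
have inj : forall F, psi p F = 0 -> F = 0.
  apply/(row_free_basis (psilin p) (psiM p))/row_free_minor; exists g.
  exact: dp.
apply: (@dim_le_functionals _ _ _ L) => // F Fp LF.
by apply: inj; apply/psi_fat.
Qed.
End Semicontinuity.

(** The extra factors [x0 i] force the points into chart 0. They also make each block of a
    nonvanishing vector nonzero, so the vector rescales to coordinates of actual points. *)
Lemma multihomog_nonvanishing (K : numFieldType) n (I : eqType) (s : seq I)
    (F : I -> {mpoly K[n * 3]}) :
  (forall i, exists e, multideg e (F i)) ->
  (forall i, i \in s -> exists p, eval_points (F i) p != 0) ->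
  exists2 f, multihomog f & (exists p, eval_points f p != 0) /\
    forall p, eval_points f p != 0 ->
      in_chart0 p /\ forall i, i \in s -> eval_points (F i) p != 0.
Proof.
move=> Fe Fs; pose x0 (i : 'I_n) : {mpoly K[n * 3]} := 'X_(mxvec_index i o0).
have x0p (i : 'I_n) p : (x0 i).@[coords p] = hcoord (tnth p i) 0 o0.
  by rewrite /x0 mevalXU coordsE.
have x0e i : multideg (fun i' => i == i' : nat) (x0 i).
  apply: (multideg_ext (@multidegXn _ _ i o0 1)) => i'.
  by rewrite muln1.
pose G (x : 'I_n + I) := match x with inl i => x0 i | inr j => F j end.
pose S : seq ('I_n + I) := map inl (enum 'I_n) ++ map inr s.
pose f := \prod_(x <- S) G x.
have /choice[E GE] : forall x, exists e, multideg e (G x).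
  by move=> -[i|j] /=; [exists (fun i' => i == i' : nat)|apply: Fe].
have fe := @multideg_prod _ _ _ S E G GE.
exists f; first by eexists; apply: fe.
split; last first.
  move=> p; rewrite /eval_points -/(coords p) rmorph_prod prodf_seq_neq0.
  move=> /allP H; split => [i|j js].
    by rewrite -x0p; apply: (H (inl i)); rewrite mem_cat map_f ?mem_enum.
  by apply: (H (inr j)); rewrite mem_cat (map_f inr) ?orbT.
have [|v vf] := @nonvanishing_prod _ _ _ S G.
  move=> [i|j]; rewrite mem_cat => /orP[/mapP[k kS]|/mapP[k kS]] // [E'].
    exists (fun=> 1); by rewrite /= /x0 mevalXU oner_neq0.
  by rewrite E'; have [p pF] := Fs k kS; exists (coords p).
have v0 i : v (mxvec_index i o0) != 0.
  move: vf; rewrite rmorph_prod prodf_seq_neq0 => /allP/(_ (inl i)).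
  by rewrite mem_cat map_f ?mem_enum //= /x0 mevalXU; apply.
have /fin_all_exists [P PE] (i : 'I_n) : exists p : P2 K, exists2 c, c != 0 &
    forall j, hcoord p 0 j = c * v (mxvec_index i j).
  have [|p [c c0 pE]] := @line_point _ (\row_(j < 3) v (mxvec_index i j)).
    by apply: contra_neq (v0 i) => /rowP/(_ o0); rewrite !mxE.
  by exists p, c => // j; rewrite pE !mxE.
have /choice[c cP] : forall i, exists c, c != 0 /\
    forall j, hcoord (P i) 0 j = c * v (mxvec_index i j).
  by move=> i; have [c c0 cE] := PE i; exists c.
exists [tuple P i | i < n]; rewrite /eval_points -/(coords _).
rewrite (multideg_scale (c := c) (v := v) fe); last first.
  by move=> i j; rewrite coordsE tnth_mktuple (cP i).2.
rewrite mulf_neq0 //; apply/prodf_neq0 => i _.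
by rewrite expf_neq0 // (cP i).1.
Qed.

(** * Column sums of a semiuniform sequence *)

Section ColumnSums.
Variables (n : nat) (m : n.-tuple nat).
Local Notation c := (col_sum m).
Local Open Scope nat_scope.

Lemma col_sumE j : c j = \sum_(i < n) (nth 0 m i - j).
Proof. by apply: eq_bigr => i _; rewrite (tnth_nth 0). Qed.

Lemma col_sum0 : c 0 = psum m n.
Proof. by rewrite col_sumE; apply: eq_bigr => i _; rewrite subn0. Qed.

Lemma col_sum_step j : c j <= c j.+1 + n.
Proof.
rewrite -[X in _ + X]card_ord -sum1_card -big_split /=.
by apply: leq_sum => i _; lia.
Qed.

Lemma drops1_col_sum : drops 1 c.
Proof.
move=> j; have [/eqP|] := posnP (c j).
  rewrite sum_nat_eq0 => /forallP z; rewrite /col_sum big1 // => i _.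
  by have := z i; rewrite /= => /eqP; lia.
move=> cj; rewrite subn1 -ltnS (prednK cj); move: cj.
case: (pickP (fun i => j < tnth m i)) => [i ji _|z].
  rewrite /col_sum (bigD1 i) //= [ltnRHS](bigD1 i) //=.
  rewrite -addSn leq_add //; first by lia.
  by apply: leq_sum => k _; lia.
by rewrite /col_sum big1 // => i _; have := z i; lia.
Qed.

(** Summing by rows instead of columns: I_c has the same colength as the fat points. *)
Lemma col_sum_total : \sum_(j < c 0) c j = \sum_(i < n) 'C((tnth m i).+1, 2).
Proof.
rewrite exchange_big /=; apply: eq_bigr => i _.
have := curve_dim_bin (c 0) (tnth m i).
rewrite (_ : tnth m i - c 0 = 0) ?addn0 //.
by apply/eqP; rewrite subn_eq0 /col_sum (bigD1 i) //= subn0 leq_addr.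
Qed.

Lemma col_sum_last : c (c 0) = 0.
Proof. exact: col_sum_eq0. Qed.

Variable r : nat.
Hypotheses (rn : 0 < r <= n) (ms : semiuniform r m).

Lemma semiuniform_antitone i j : i <= j < n -> nth 0 m j <= nth 0 m i.
Proof.
case/andP=> ij jn; case: ms => _ sm.
apply: (sorted_leq_nth (leT := geq)) => //.
- by move=> a b e /= ab eb; apply: leq_trans ab.
- by move=> a /=.
- by rewrite inE size_tuple; lia.
- by rewrite inE size_tuple.
Qed.

Lemma semiuniform_top i : i < n -> nth 0 m i <= (nth 0 m r.-1).+1.
Proof.
by move=> i_n; case: ms => h _; apply: leq_trans h; apply: semiuniform_antitone.
Qed.

Lemma sum_split (f : nat -> nat) :
  \sum_(i < n) f i = \sum_(i < r) f i + \sum_(r <= i < n) f i.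
Proof.
rewrite -(big_mkord xpredT f) (big_cat_nat (n := r)) //; last by lia.
by rewrite big_mkord.
Qed.

(** If j < m_r, the first r entries all exceed j, and each loses one on passing to j + 1. If j >=
    m_r, semiuniformity bounds all entries by j + 1, so c_(j+1) = 0. *)
Lemma drops_col_sum : drops r c.
Proof.
move=> j; have [ja|aj] := ltnP j (nth 0 m r.-1); last first.
  rewrite col_sumE big1 // => i _; have := semiuniform_top (ltn_ord i); lia.
rewrite leq_subRL; last first.
  rewrite col_sumE (sum_split (fun i => nth 0 m i - j)).
  rewrite (leq_trans _ (leq_addr _ _)) //.
  rewrite -[leqLHS]card_ord -sum1_card; apply: leq_sum => i _.
  by have := @semiuniform_antitone i r.-1 ltac:(have := ltn_ord i; lia); lia.
rewrite !col_sumE !(sum_split (fun i => nth 0 m i - _)) addnA; apply: leq_add.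
  rewrite -[X in X + _]card_ord -sum1_card -big_split; apply: leq_sum => i _ /=.
  by have := @semiuniform_antitone i r.-1 ltac:(have := ltn_ord i; lia); lia.
by apply: leq_sum => i _; lia.
Qed.

(** For the upper bound take j = m_r in [mu_le]: only the first r entries can exceed m_r. For the
    lower bound, M_r counts pairs (i, j) with i < r and j < m_i, at most min(r, c_j) of them in
    column j. *)
Lemma mu_col_sum : mu r (c 0) c = psum m r.
Proof.
apply/eqP; rewrite eqn_leq; apply/andP; split.
  apply: leq_trans (mu_le (c 0) (nth 0 m r.-1) drops_col_sum) _.
  rewrite col_sumE (sum_split (fun i => nth 0 m i - nth 0 m r.-1)).
  rewrite [X in _ + X + _]big1_seq ?addn0 => [|i]; last first.
    rewrite mem_index_iota => /andP[_ /andP[ri i_n]].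
    by have := @semiuniform_antitone r.-1 i ltac:(lia); lia.
  rewrite mulnC -[X in _ + X * _]card_ord -sum_nat_const -big_split /psum.
  apply: leq_sum => i _ /=.
  by have := @semiuniform_antitone i r.-1 ltac:(have := ltn_ord i; lia); lia.
rewrite /psum /mu.
have -> : \sum_(i < r) nth 0 m i =
    \sum_(i < r) \sum_(j < c 0) (j < nth 0 m i).
  apply: eq_bigr => i _.
  have mi : nth 0 m i <= c 0.
    have i_n : i < n by have := ltn_ord i; lia.
    by rewrite col_sumE (bigD1 (Ordinal i_n)) //= subn0 leq_addr.
  rewrite -{1}[nth 0 m i]card_ord -sum1_card.
  rewrite (big_ord_widen _ (fun=> 1) mi) big_mkcond /=.
  by apply: eq_bigr => j _; case: ltnP.
rewrite exchange_big /=; apply: leq_sum => j _.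
rewrite leq_min; apply/andP; split.
  rewrite -[leqRHS]card_ord -sum1_card; apply: leq_sum => i _; exact: leq_b1.
rewrite (col_sumE j) (sum_split (fun i => nth 0 m i - j)).
rewrite (leq_trans _ (leq_addr _ _)) //.
by apply: leq_sum => i _; case: ltnP; lia.
Qed.
End ColumnSums.

(** * Hilbert function at general points *)

Lemma hilb_minimal (K : numFieldType) n (m : n.-tuple nat) t :
  exists2 p0 : n.-tuple (P2 K), in_chart0 p0 &
    forall p : n.-tuple (P2 K), in_chart0 p -> (hilb m p0 t <= hilb m p t)%N.
Proof.
pose P h := `[< exists2 p0 : n.-tuple (P2 K), in_chart0 p0 & hilb m p0 t = h >].
have exP : exists h, P h.
  have [p gp _] :=
    special_position K t 0 0 (isT : (0 < 1)%N) (drops1_col_sum m).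
  by exists (hilb m p t); apply/asboolP; exists p.
case: (ex_minnP exP) => h /asboolP[p0 gp0 <-] hmin.
by exists p0 => // p gp; apply: hmin; apply/asboolP; exists p.
Qed.

(** The bound T leaves finitely many open conditions, whose intersection is given by one product. *)
Lemma general_hilb_minimal (K : numFieldType) n (m : n.-tuple nat) T :
  general_points (fun p : n.-tuple (P2 K) => in_chart0 p /\
    forall t, (t <= T)%N ->
    forall p0 : n.-tuple (P2 K), in_chart0 p0 -> (hilb m p t <= hilb m p0 t)%N).
Proof.
have F t : exists f : {mpoly K[n * 3]}, [/\ exists e, multideg e f,
    exists p : n.-tuple (P2 K), eval_points f p != 0 &
    forall p : n.-tuple (P2 K), in_chart0 p -> eval_points f p != 0 ->
      forall p0 : n.-tuple (P2 K), in_chart0 p0 ->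
        (hilb m p t <= hilb m p0 t)%N].
  have [p0 gp0 p0min] := hilb_minimal K m t.
  have [f fe [fp0 fmin]] := hilb_semicontinuous m t gp0.
  exists f; split => //; first by exists p0.
  by move=> p gp fp p1 /p0min; apply: leq_trans; apply: fmin.
have /choice[f fP] := F.
have [||Phi mPhi [exPhi PhiP]] :=
  @multihomog_nonvanishing K n _ (iota 0 T.+1) f.
- by move=> t; have [] := fP t.
- by move=> t _; have [] := fP t.
exists (fun p => eval_points Phi p != 0); split => //.
  exists (fun f => f = Phi); split => [_ -> //|p].
  by split=> [pPhi|[_ [-> //]]]; exists Phi.
move=> p /PhiP[gp H]; split => // t tT; have [_ _] := fP t; apply => //.
by apply: H; rewrite mem_iota /= add0n ltnS.
Qed.

Section Generic.
Variables (K : numFieldType) (n : nat) (m : n.-tuple nat) (p : n.-tuple (P2 K)).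
Variable T : nat.
Local Notation c := (col_sum m).
Local Notation colength := (\sum_(i < n) 'C((tnth m i).+1, 2))%N.
Hypotheses (gp : in_chart0 p)
  (pmin : forall t, (t <= T)%N ->
    forall p0 : n.-tuple (P2 K), in_chart0 p0 -> (hilb m p t <= hilb m p0 t)%N).

Definition expected_dim t : Prop := (hilb m p t + colength)%N = 'C(t.+2, 2).

Lemma hilb_bound d r k t : (0 < d)%N -> drops r c -> (t <= T)%N ->
  (hilb m p t <= hbound d r (c 0) k t.+1 c)%N.
Proof.
move=> d0 dc tT.
have [p0 gp0 p0h] := special_position K t (c 0) k d0 dc.
exact: leq_trans (pmin tT gp0) p0h.
Qed.

Lemma expected_dimP d r k t : (0 < d)%N -> drops r c -> (t <= T)%N ->
  (hbound d r (c 0) k t.+1 c + \sum_(j < c 0) c j = 'C(t.+2, 2))%N ->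
  expected_dim t.
Proof.
move=> d0 dc tT E; apply/eqP; rewrite eqn_leq (hilb_ge m t gp) andbT -E.
by rewrite -col_sum_total leq_add2r hilb_bound.
Qed.

(** Residuation by a line, with d = r = 1, u = c_0 - 1 and rho = 1. It makes tau exist and be at
    most c_0. *)
Lemma expected_dim_exists : (0 < c 0)%N -> (c 0 <= T)%N -> expected_dim (c 0).
Proof.
move=> c0 cT.
apply: (@expected_dimP 1 1 (c 0).-1.+1) => //; first exact: drops1_col_sum.
have cE : c 0 = ((c 0).-1 * 1 + 1)%N by rewrite muln1 addn1 prednK.
apply: (@tau_core 1 1 (c 0) (c 0).-1 1 c isT (drops1_col_sum m)
  (col_sum_last m) cE isT isT (c 0)).
- by rewrite muln1 addn0.
- by lia.
move=> i i_le; rewrite exp1n.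
by have := mu_le0 (c 0) (drops_sub (i * 1) (drops1_col_sum m)); lia.
Qed.

(** * The bounds in cases (a), (b) and (c) *)

Section Bounds.
Variables d r u rho : nat.
Hypotheses (d_gt0 : (0 < d)%N) (rn : (0 < r <= n)%N) (ms : semiuniform r m).
Hypotheses (cE : psum m n = (u * r + rho)%N) (rho_gt0 : (0 < rho)%N)
  (rho_le : (rho <= r)%N).
Local Notation g := 'C(d.-1, 2).

Let dc : drops r c := drops_col_sum rn ms.
Let cJ : c (c 0) = 0%N := col_sum_last m.
Let c0 : c 0 = (u * r + rho)%N. Proof. by rewrite col_sum0. Qed.
Let cn := col_sum_step m.
Let muM := mu_col_sum rn ms.

Section Alpha.
Variables s t : nat.
Hypotheses (srho : (s.+1 * s.+2 <= 2 * rho)%N) (sd : (s < d)%N).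
Hypotheses (tsu : (t <= s + u * d)%N) (tT : (t <= T)%N).

Lemma hilb0 : hbound d r (c 0) u.+1 t.+1 c = 0%N -> hilb m p t = 0%N.
Proof.
by move=> h0; apply/eqP; rewrite -leqn0 -h0; apply: hilb_bound.
Qed.

Lemma alpha_a : (r <= d ^ 2)%N -> ('C(d.+1, 2) <= r)%N ->
  (t * d < psum m r + g)%N -> hilb m p t = 0%N.
Proof.
move=> rd dr tg; apply: hilb0.
apply: (alpha_drop d_gt0 cJ c0 rho_gt0 rho_le srho sd tsu dr tg) => i _.
rewrite -muM; apply: leq_trans (mu_step_ge (c 0) i dc) _.
by rewrite leq_add2l leq_mul2l rd orbT.
Qed.

Lemma alpha_b : (n + d ^ 2 <= 2 * r)%N -> hilb m p t = 0%N.
Proof.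
move=> nd; apply: hilb0.
apply: (alpha_steep d_gt0 cJ c0 rho_gt0 rho_le srho sd tsu) => i.
exact: (mu_steep d_gt0 dc cJ c0 rho_gt0 rho_le cn nd).
Qed.

Lemma alpha_c b : (forall i, tnth m i = b) -> ('C(d.+1, 2) <= r)%N ->
  (r ^ 2 <= d ^ 2 * n)%N -> (t * d < b * r + g)%N -> hilb m p t = 0%N.
Proof.
move=> mb dr rd tg; apply: hilb0.
apply: (alpha_drop d_gt0 cJ c0 rho_gt0 rho_le srho sd tsu dr tg) => i iu.
apply: (mu_uniform d_gt0 dc cJ c0 rho_gt0 rho_le cn _ _ rd (ltnW iu)).
  by case/andP: rn.
rewrite /col_sum; under eq_bigr do rewrite mb subn0.
by rewrite sum_nat_const card_ord mulnC.
Qed.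
End Alpha.

Section Tau.
Variable t : nat.
Hypotheses (tu : (u * d + d <= t.+2)%N) (tT : (t <= T)%N).

Lemma tau_a : (r <= d ^ 2)%N -> (rho + u * d ^ 2 + g <= (t * d).+1)%N ->
  expected_dim t.
Proof.
move=> rd tg; apply: (expected_dimP d_gt0 dc tT).
apply: (tau_core d_gt0 dc cJ c0 rho_gt0 rho_le tg tu) => i iu.
exact: (mu_flat d_gt0 dc cJ c0 rho_gt0 rho_le iu rd).
Qed.

Lemma tau_b : (n + d ^ 2 <= 2 * r)%N -> (psum m r + g <= (t * d).+1)%N ->
  expected_dim t.
Proof.
move=> nd tg; apply: (expected_dimP d_gt0 dc tT).
apply: (tau_core d_gt0 dc cJ c0 rho_gt0 rho_le tg tu) => i iu.
by rewrite -muM; apply: (mu_steep_chain d_gt0 dc cJ c0 rho_gt0 rho_le cn nd iu).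
Qed.
End Tau.

Lemma psum_gt0 : (0 < psum m r)%N.
Proof.
rewrite -muM; apply: leq_trans (mu_ge0 _ cJ).
by rewrite c0 leq_min; case/andP: rn => -> _; rewrite addn_gt0 rho_gt0 orbT.
Qed.
End Bounds.
End Generic.

(** * Floors and ceilings as inequalities of natural numbers *)

Section Rounding.
Variables (a g d : nat).
Hypothesis d_gt0 : (0 < d)%N.
Local Notation x := ((a%:R + g%:R - 1) / d%:R : rat).

Lemma le_floor_nat (t : nat) : (t%:Z <= Num.floor x) = (t * d < a + g)%N.
Proof.
rewrite floor_ge_int ler_pdivlMr ?ltr0n // lerBrDr -[t%:Z%:~R]/(t%:R : rat).
by rewrite -natrM -!natrD natr1 ler_nat.
Qed.

Lemma ceil_le_nat (t : nat) : (Num.ceil x <= t%:Z) = (a + g <= (t * d).+1)%N.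
Proof.
rewrite ceil_le_int ler_pdivrMr ?ltr0n // lerBlDr -[t%:Z%:~R]/(t%:R : rat).
by rewrite -natrM -!natrD natr1 ler_nat.
Qed.

Lemma ceil_nat_ge0 : (0 < a)%N -> 0 <= Num.ceil x.
Proof.
move=> a0; rewrite ceil_ge0 (lt_le_trans (ltrN10 _)) // divr_ge0 ?ler0n //.
by rewrite subr_ge0 -natrD ler1n addn_gt0 a0.
Qed.
End Rounding.

Theorem mainTheorem2 (R : realType) (n : nat) (m : n.-tuple nat)
    (hm : exists i : 'I_n, tnth m i <> 0%N) :
  general_points (fun p : n.-tuple (P2 R[i]) =>
    exists alpha tau : nat,
    [/\ is_alpha m p alpha, is_tau m p tau &
    forall d r : nat, (0 < d)%N -> (0 < r <= n)%N -> semiuniform r m ->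
    forall u rho s : nat,
    psum m n = (u * r + rho)%N -> (0 < rho <= r)%N ->
    is_greatest (fun k => (k.+1 * k.+2 <= 2 * rho)%N /\ (k < d)%N) s ->
    let g : nat := ((d.-1 * d.-2) %/ 2)%N in
    let M : nat -> nat := psum m in
    [/\ ((r <= d ^ 2)%N ->
          (((d * d.+1) %/ 2 <= r)%N ->
             1 + Num.min (Num.floor (((M r)%:R + g%:R - 1) / d%:R : rat))
                         (s%:Z + u%:Z * d%:Z)
               <= alpha%:Z) /\
          tau%:Z <=
            Num.max (Num.ceil ((rho%:R + g%:R - 1) / d%:R : rat) + u%:Z * d%:Z)
                    (u%:Z * d%:Z + d%:Z - 2)),
        ((n + d ^ 2 <= 2 * r)%N ->
          s%:Z + u%:Z * d%:Z + 1 <= alpha%:Z /\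
          tau%:Z <=
            Num.max (Num.ceil (((M r)%:R + g%:R - 1) / d%:R : rat))
                    (u%:Z * d%:Z + d%:Z - 2)) &
        (forall c : nat, (forall i : 'I_n, tnth m i = c) ->
          ((r * (d * d.+1)) %/ 2 <= r ^ 2)%N -> (r ^ 2 <= d ^ 2 * n)%N ->
          1 + Num.min (Num.floor ((c%:R * r%:R + g%:R - 1) / d%:R : rat))
                      (s%:Z + u%:Z * d%:Z)
            <= alpha%:Z)]]).
Proof.
pose len := (\sum_(i < n) 'C((tnth m i).+1, 2))%N.
(* Since tau <= c_0 and alpha <= [len], degrees up to T suffice. T depends on m alone, so one open
   set serves all d and r. *)
pose T := maxn (col_sum m 0) len.
have c_gt0 : (0 < col_sum m 0)%N.
  have [i mi] := hm; rewrite /col_sum (bigD1 i) //= subn0 addn_gt0.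
  by case: (tnth m i) mi.
have [U [openU exU UP]] := general_hilb_minimal R[i] m T.
exists U; split => // p /UP[gp pmin].
have expT : expected_dim m p (col_sum m 0).
  by apply: (expected_dim_exists gp pmin c_gt0); apply: leq_maxl.
have len_pos : (0 < hilb m p len)%N.
  have := hilb_ge m len gp; rewrite -/len !binS2.
  by move: (hilb m p len) ('C(len, 2)) => x y; lia.
have exa : exists t, (0 < hilb m p t)%N by exists len.
have exta : exists t, (hilb m p t + len == 'C(t.+2, 2))%N.
  by exists (col_sum m 0); apply/eqP.
have tauE t : (hilb m p t)%:Z =
    'C(t.+2, 2)%:Z - \sum_(i < n) 'C((tnth m i).+1, 2)%:Z <->
    expected_dim m p t.
  rewrite -(big_morph Posz PoszD (erefl _)) /expected_dim -/len.
  by move: (hilb m p t) ('C(t.+2, 2)) => x y; clearbody len; split; lia.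
have [alpha a_pos a_min] := ex_minnP exa.
have [tau /eqP tau_exp tau_min] := ex_minnP exta.
have alphaT : (alpha <= T)%N.
  by apply: leq_trans (leq_maxr _ _); apply: a_min.
have tauT : (tau <= T)%N.
  by apply: leq_trans (leq_maxl _ _); apply/tau_min/eqP.
exists alpha, tau; split.
- by split => // t; apply: a_min.
- split; first exact/tauE.
  by move=> t /tauE/eqP; apply: tau_min.
move=> d r d0 rn ms u rho s cE /andP[rho0 rhor] [[srho sd] _] g M.
have gE : g = 'C(d.-1, 2) by rewrite bin2 -divn2.
have dE : ((d * d.+1) %/ 2)%N = 'C(d.+1, 2) by rewrite bin2 divn2 mulnC.
have M_gt0 := psum_gt0 rn ms cE rho0.
(* If the bound failed, alpha would be at most both entries of the minimum; each case refutes this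
   by showing that the Hilbert function vanishes in degree alpha. *)
have to_alpha (A : int) : ~ (alpha%:Z <= A /\ (alpha <= s + u * d)%N) ->
    1 + Num.min A (s%:Z + u%:Z * d%:Z) <= alpha%:Z.
  move=> H; rewrite leNgt; apply/negP => h; apply: H.
  have : alpha%:Z <= Num.min A (s%:Z + u%:Z * d%:Z) by lia.
  by rewrite le_min => /andP[hA hB]; split => //; lia.
have to_tau (B : int) : 0 <= B -> (forall t : nat, t%:Z = B -> (t <= T)%N ->
    expected_dim m p t) -> tau%:Z <= B.
  case: B => // t _ H; rewrite lez_nat leqNgt; apply/negP => tt.
  have /tau_min : (hilb m p t + len == 'C(t.+2, 2))%N.
    by apply/eqP/H => //; apply: leq_trans (ltnW tt) tauT.
  by rewrite leqNgt tt.
have alpha_absurd : hilb m p alpha <> 0%N by move=> h0; rewrite h0 in a_pos.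
rewrite gE dE; split.
- move=> rd; split.
    move=> dr; apply: to_alpha => -[]; rewrite le_floor_nat // => h1 h2.
    apply: alpha_absurd.
    exact: (alpha_a pmin d0 rn ms cE rho0 rhor srho sd h2 alphaT rd dr h1).
  apply: to_tau => [|t tE tT].
    rewrite le_max addr_ge0 //; apply: ceil_nat_ge0 => //.
  have c0 := ceil_nat_ge0 'C(d.-1, 2) d rho0.
  have : Num.max (Num.ceil ((rho%:R + 'C(d.-1, 2)%:R - 1) / d%:R : rat) +
    u%:Z * d%:Z) (u%:Z * d%:Z + d%:Z - 2) <= t%:Z by rewrite tE.
  rewrite ge_max => /andP[h1 h2].
  (* The ceiling is nonnegative because rho > 0, so t - u d is not truncated. *)
  have tu : (u * d <= t)%N by lia.
  have : Num.ceil ((rho%:R + 'C(d.-1, 2)%:R - 1) / d%:R : rat) <=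
    (t - u * d)%N%:Z by lia.
  rewrite ceil_le_nat // => h3.
  apply: (tau_a gp pmin d0 rn ms cE rho0 rhor _ tT rd); first by lia.
  rewrite -(subnK tu) mulnDl -mulnA mulnn -addnA [(u * _ + _)%N]addnC addnA.
  by rewrite -addSn leq_add2r.
- move=> nd; split.
    have : ~ (alpha <= s + u * d)%N.
      move=> h; apply: alpha_absurd.
      exact: (alpha_b pmin d0 rn ms cE rho0 rhor srho sd h alphaT nd).
    by lia.
  apply: to_tau => [|t tE tT].
    by rewrite le_max ceil_nat_ge0.
  have : Num.max (Num.ceil (((M r)%:R + 'C(d.-1, 2)%:R - 1) / d%:R : rat))
    (u%:Z * d%:Z + d%:Z - 2) <= t%:Z by rewrite tE.
  rewrite ge_max ceil_le_nat // => /andP[h1 h2].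
  by apply: (tau_b gp pmin d0 rn ms cE rho0 rhor _ tT nd h1); lia.
- move=> b mb dr rd.
  have r0 : (0 < r)%N by case/andP: rn.
  (* As d (d + 1) is even, the halved product is exactly r C(d + 1, 2), and r > 0 cancels. *)
  have dr' : ('C(d.+1, 2) <= r)%N.
    rewrite -(leq_pmul2l r0) mulnn (leq_trans _ dr) //.
    by rewrite [(d * _)%N]mulnC -bin2_mul mulnA mulnK.
  apply: to_alpha => -[]; rewrite -natrM le_floor_nat // => h1 h2.
  apply: alpha_absurd.
  exact: (alpha_c pmin d0 rn ms cE rho0 rhor srho sd h2 alphaT mb dr' rd h1).
Qed.
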